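(* For each $N\ge 1$ let $$X_N=\begin{bmatrix} a_N & -b_N^*\\ b_N & C_N\end{bmatrix}\in\mathbb{C}^{(N+1)\times(N+1)},\qquad H_N=\begin{bmatrix}-1&0\\0&I_N\end{bmatrix},$$ where $a_N$ is a real-valued random variable, $b_N$ is a random vector in $\mathbb{C}^N$ and $C_N$ is a random hermitian matrix in $\mathbb{C}^{N\times N}$; let $s\ge0$. Assume: (R0) For each $N>0$ the random variable $a_N$ is independent of the entries of the vector $b_N$ and of the entries of the matrix $C_N$; furthermore $a_N\to0$ in probability as $N\to\infty$. (R1) $b_N=\frac{1}{\sqrt N}[x_{j0}]_{j=1,\dots,N}$, where $(x_{j0})_{j>0}$ are i.i.d. (real or complex) random variables, independent of the entries of $C_N$ for every $N>0$, of zero mean and with $E|x_{j0}|^2=s^2$ for $j>0$. (R2) The random measure $\nu_N=\frac1N\sum_{j=1}^N\delta_{\lambda_j^N}$, where $\lambda_1^N\le\cdots\le\lambda_N^N$ are the eigenvalues of $C_N$, converges as $N\to\infty$ weakly in probability to some non-random measure $\mu_0$ on $\mathbb{R}$. Then the eigenvalue of nonpositive type $\beta_N$ of $X_N$ converges in probability, as $N\to\infty$, to the generalized zero of nonpositive type (GZNT) $\beta_0$ of the function $$Q_0(z)=-z+s^2\hat\mu_0(z).$$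
   Context: $\mathbb{C}^+$ is the open upper half-plane. A matrix $X$ is $H$-selfadjoint if $X^*H=HX$; $X_N$ is $H_N$-selfadjoint. Write $[x,y]_{H}=y^*Hx$. By a theorem of Pontryagin, there is exactly one $\beta_N\in\mathbb{C}^+\cup\mathbb{R}$ which is an eigenvalue of $X_N$ possessing an eigenvector $x\neq0$ with $[x,x]_{H_N}\le0$; it is called the eigenvalue of nonpositive type of $X_N$. For a positive bounded Borel measure $\mu$ on $\mathbb{R}$, $\hat\mu(z)=\int_{\mathbb{R}}\frac{1}{t-z}\,d\mu(t)$ is its Stieltjes transform. For a function $Q(z)=\hat\mu(z)+a-z$ with $\mu$ a positive bounded Borel measure on $\mathbb{R}$ and $a\in\mathbb{R}$, it is known that there is precisely one $z_0\in\mathbb{C}^+\cup\mathbb{R}$ such that either $z_0\in\mathbb{C}^+$ and $Q(z_0)=0$, or $z_0\in\mathbb{R}$ and the non-tangential limit $\lim_{z\hat\to z_0}\frac{Q(z)}{z-z_0}$ exists and belongs to $(-\infty,0]$. Here $z\hat\to z_0$ means $z\in\mathbb{C}^+$, $z\to z_0$, with $\pi/2-\theta\le\arg(z-z_0)\le\pi/2+\theta$, $\theta\in(0,\pi/2)$ fixed. This $z_0$ is the generalized zero of nonpositive type (GZNT) of $Q$. Random measures $\nu_N$ converge weakly in probability to $\mu_0$ if $\int f\,d\nu_N\to\int f\,d\mu_0$ in probability for every bounded continuous $f:\mathbb{R}\to\mathbb{R}$. The entries of $C_N$ may be real or complex. *)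

(* Defs.v *)
From HB Require Import structures.
From mathcomp Require Import all_boot all_order all_algebra finmap.
From mathcomp Require Import sesquilinear spectral.
From mathcomp.real_closed Require Import complex.
From mathcomp Require Import all_classical all_reals all_analysis.

Set Implicit Arguments.
Unset Strict Implicit.
Unset Printing Implicit Defensive.

Import Order.TTheory GRing.Theory Num.Theory.
Import numFieldNormedType.Exports.

Local Open Scope classical_set_scope.
Local Open Scope ring_scope.
Local Open Scope sesquilinear_scope.
Local Open Scope complex_scope.

Section IndefiniteForms.
Context {R : realType}.
Implicit Types z : R[i].

Definition indef_form n (H : 'M[R[i]]_n) (x y : 'cV[R[i]]_n) : R[i] :=
  (y ^t* *m H *m x) 0 0.

(* The order on R[i] compares only numbers with equal imaginary parts, so the
   last condition says that [x, x]_H is real and nonpositive. *)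
Definition nonpositive_type_eigenvalue n (H X : 'M[R[i]]_n) z : Prop :=
  0 <= complex.Im z /\
  exists x : 'cV[R[i]]_n, [/\ x != 0, X *m x = z *: x & indef_form H x x <= 0].

Definition bordered_mx n (a : R) (b : 'cV[R[i]]_n) (C : 'M[R[i]]_n) :
    'M[R[i]]_(1 + n) :=
  block_mx (a%:C)%:M (- b ^t*) b C.

Definition pontryagin_mx n : 'M[R[i]]_(1 + n) :=
  block_mx (-1)%:M 0 0 1%:M.

(* The n eigenvalues of C, all real, with multiplicities and in nondecreasing
   order. *)
Definition ordered_eigenvalues n (C : 'M[R[i]]_n) (l : n.-tuple R) : Prop :=
  sorted <=%R l /\ char_poly C = \prod_(t <- l) ('X - (t%:C)%:P).

Definition empirical_measure n (l : n.-tuple R) : {measure set R -> \bar R} :=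
  mscale (n%:R^-1)%:nng (msum (fun j => \d_(nth 0 l j)) n).

End IndefiniteForms.

Section ComplexIntegral.
Context {R : realType}.

Definition reim (z : R[i]) : R * R := (complex.Re z, complex.Im z).

Definition complex_integral d (T : measurableType d)
    (mu : {measure set T -> \bar R}) (f : T -> R[i]) : R[i] :=
  (\int[mu]_(t in setT) complex.Re (f t)) +i* (\int[mu]_(t in setT) complex.Im (f t)).

Definition stieltjes (mu : {measure set R -> \bar R}) (z : R[i]) : R[i] :=
  complex_integral mu (fun t : R => (t%:C - z)^-1).

(* z is in the open upper half-plane and z - z0, in polar coordinates, has an
   argument in [pi/2 - theta, pi/2 + theta]. *)
Definition stolz_sector (theta : R) (z0 : R[i]) : set R[i] :=
  [set z | 0 < complex.Im z /\
    exists r phi : R, [/\ 0 < r, pi / 2 - theta <= phi <= pi / 2 + theta &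
      z - z0 = r%:C * (cos phi +i* sin phi)]].

(* Generalized zero of nonpositive type. R[i]^o is R[i] with the topology of the
   modulus; the limit is taken inside the Stolz sector of half-angle theta. *)
Definition gznt (theta : R) (Q : R[i] -> R[i]) (z0 : R[i]) : Prop :=
  (0 < complex.Im z0 /\ Q z0 = 0) \/
  (complex.Im z0 = 0 /\ exists2 L : R, L <= 0 &
     (fun z : R[i]^o => Q z / (z - z0) : R[i]^o)
       @ within (stolz_sector theta z0) (nbhs (z0 : R[i]^o))
       --> (L%:C : R[i]^o)).

End ComplexIntegral.

Section Probability.
Context {R : realType} d {T : measurableType d} (P : probability T R).

(* R[i] carries no measurable structure in the library; its Borel sigma-algebra
   is taken from R * R through reim. *)
Definition complex_rv (Z : T -> R[i]) : Prop := measurable_fun setT (reim \o Z).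

Definition generated_by (I : Type) (Z : I -> T -> R[i]) : set (set T) :=
  <<s \bigcup_i preimage_set_system setT (reim \o Z i) measurable >>.

Definition generated_by_entries m n (M : T -> 'M[R[i]]_(m, n)) : set (set T) :=
  generated_by (fun ij : 'I_m * 'I_n => fun w => M w ij.1 ij.2).

Definition rescaled_col (x : nat -> T -> R[i]) n (w : T) : 'cV[R[i]]_n :=
  \col_(j < n) (((Num.sqrt n%:R)^-1)%:C * x j w).

Definition independent_systems (F G : set (set T)) : Prop :=
  forall A B, F A -> G B -> P (A `&` B) = (P A * P B)%E.

Definition mutually_independent (I : choiceType) (Z : I -> T -> R[i]) : Prop :=
  forall (J : {fset I}) (A : I -> set (R * R)),
    (forall j, measurable (A j)) ->
    P (\bigcap_(j in [set` J]) ((reim \o Z j) @^-1` A j)) =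
    (\prod_(j <- J) P ((reim \o Z j) @^-1` A j))%E.

Definition same_law (Z W : T -> R[i]) : Prop :=
  forall A : set (R * R), measurable A ->
    P ((reim \o Z) @^-1` A) = P ((reim \o W) @^-1` A).

(* A measure of the library takes unspecified values on nonmeasurable sets, so
   measurability of the sequence is part of convergence in probability. *)
Definition cvg_in_probability (X : nat -> T -> R) (c : R) : Prop :=
  (forall N, measurable_fun setT (X N)) /\
  forall eps : R, 0 < eps ->
    P [set w | eps < `|X N w - c|] @[N --> \oo] --> 0%E.

Definition complex_cvg_in_probability (Z : nat -> T -> R[i]) (c : R[i]) : Prop :=
  (forall N, complex_rv (Z N)) /\
  forall eps : R, 0 < eps ->
    P [set w | eps < Normc.normc (Z N w - c)] @[N --> \oo] --> 0%E.

Definition weak_cvg_in_probability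
    (nu : nat -> T -> {measure set R -> \bar R})
    (mu : {measure set R -> \bar R}) : Prop :=
  forall f : R -> R, continuous f -> bounded_fun f ->
    cvg_in_probability (fun N w => \int[nu N w]_(t in setT) f t)
      (\int[mu]_(t in setT) f t).

End Probability.

(* Main.v *)
Require Import Defs.
From HB Require Import structures.
From mathcomp Require Import all_boot all_order all_algebra.
From mathcomp Require Import sesquilinear spectral.
From mathcomp.real_closed Require Import complex.
From mathcomp Require Import all_classical all_reals all_analysis.
From mathcomp Require Import finmap ring lra measurable_realfun.

Import Order.TTheory GRing.Theory Num.Theory.
Import numFieldNormedType.Exports.

Local Open Scope classical_set_scope.
Local Open Scope ring_scope.
Local Open Scope complex_scope.

(** Why the eigenvalue converges.

An eigenvector of nonpositive type can be scaled to [(1, u)] with [|u| <= 1];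
its equations become [b + C u = beta u] and [a - b^* u = beta].  Writing [R] for
the resolvent [(C - z)^-1], the Schur function [Q(z) = a - z + b^* R b] of the
bordered matrix then factors, for [Im z > 0], as
  [Q(z) = (z - beta) (z - beta^* ) S(z)],
  [S(z) = u^* R u + (|u|^2 - 1) / (z - beta^* )]      ([schur_factor]).
[S] is the Stieltjes transform of a probability measure: the spectral measure of
[C] at [u], completed by an atom at [beta] when [|u| < 1], which forces [beta] to
be real.  What matters is a lower bound for its imaginary part that depends on
nothing but the sizes of [z], [beta] and [b]; it follows from the
Cauchy-Schwarz inequality alone ([Im_spectral_transform]).

This bound makes [beta] a continuous function of [Q], in a strong sense: one
point [z] of the upper half-plane suffices ([gznt_is_stable]).  If [beta0] is a
nonreal zero of [Q0], then [Q(beta0)] being small forces one of the first two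
factors to be small at [beta0].  If [beta0] is real, take [z = beta0 + i y] with
[y] small: [Q0(z) / (i y)] is near some [L <= 0], whereas [S(z) / (i y)] has a real
part bounded below by a positive constant, so that [beta] cannot stay away from
[beta0].

It remains to see that the random Schur functions converge to [Q0] in
probability at each fixed [z].  Their difference is the sum of [a], of [s^2] times
the error of the normalized trace of [R], and of the deviation
[b^* R b - s^2 tr R / N].  The trace is the Stieltjes transform of the empirical
measure, so weak convergence applies ([trace_error_cvg0]).  The deviation is a
law of large numbers under a second moment only ([deviation_cvg0]): truncate and
center the [x_j], compute the variance of the resulting form, which is [O(1/N)]
because all but two of the covariances attached to a pair of indices vanish
([variance_centered_form]), and bound the error of the truncation uniformly in
[N] by a tail of [E |x_0|^2] ([truncation]).

The eigenvalue also has to be shown measurable.  It is not given by a formula,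
but a vector that solves the equations approximately has a value close to
[beta] ([approx_solution_value]), so that the events [Re beta <= c] are countable
combinations of events about rational vectors
([cmeas_nonpositive_eigenvalue]). *)

Set Implicit Arguments.
Unset Strict Implicit.
Unset Printing Implicit Defensive.

Local Notation normc := Normc.normc.
(* The conjugation of [ring_scope] is only convertible to [conjc]. *)
Local Notation "z ^*" := (conjc z) : ring_scope.

(** * Complex numbers *)

Section ComplexModulus.
Context {R : realType}.
Implicit Types z w : R[i].

Lemma normc_sqr z : normc z ^+ 2 = complex.Re z ^+ 2 + complex.Im z ^+ 2.
Proof. by case: z => x y; rewrite sqr_sqrtr ?addr_ge0 ?sqr_ge0. Qed.

Lemma normc_0 : normc (0 : R[i]) = 0.
Proof. exact: Normc.normc0. Qed.

Lemma normc_ge0 z : 0 <= normc z.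
Proof. by case: z => x y; exact: sqrtr_ge0. Qed.

Lemma normc_mul z w : normc (z * w) = normc z * normc w.
Proof. exact: Normc.normcM. Qed.

Lemma normc_inv z : normc z^-1 = (normc z)^-1.
Proof. exact: Normc.normcV. Qed.

Lemma normc_add z w : normc (z + w) <= normc z + normc w.
Proof. exact: le_normcD. Qed.

Lemma normc_opp z : normc (- z) = normc z.
Proof. exact: normcN. Qed.

Lemma normc_subC z w : normc (z - w) = normc (w - z).
Proof. by rewrite -normc_opp opprB. Qed.

Lemma normc_sub z w : normc (z - w) <= normc z + normc w.
Proof. by rewrite -(normc_opp w); exact: normc_add. Qed.

Lemma normc_conj z : normc z^* = normc z.
Proof. by case: z => x y /=; rewrite sqrrN. Qed.

Lemma normc_real (x : R) : normc x%:C = `|x|.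
Proof. by rewrite /= expr0n addr0 sqrtr_sqr. Qed.

Lemma normc_eq0 z : (normc z == 0) = (z == 0).
Proof.
apply/eqP/eqP => [/Normc.eq0_normc //|->].
exact: Normc.normc0.
Qed.

Lemma Re_le_normc z : `|complex.Re z| <= normc z.
Proof.
rewrite -sqrtr_sqr -[leRHS]ger0_norm ?normc_ge0// -[leRHS]sqrtr_sqr.
by rewrite ler_wsqrtr// normc_sqr lerDl sqr_ge0.
Qed.

Lemma Im_le_normc z : `|complex.Im z| <= normc z.
Proof.
rewrite -sqrtr_sqr -[leRHS]ger0_norm ?normc_ge0// -[leRHS]sqrtr_sqr.
by rewrite ler_wsqrtr// normc_sqr lerDr sqr_ge0.
Qed.

Lemma conj_mul z : z^* * z = ((normc z) ^+ 2)%:C.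
Proof. rewrite normc_sqr; case: z => x y; simpc; congr (_ +i* _); ring. Qed.

Lemma ReD z w : complex.Re (z + w) = complex.Re z + complex.Re w.
Proof. by case: z; case: w. Qed.
Lemma ImD z w : complex.Im (z + w) = complex.Im z + complex.Im w.
Proof. by case: z; case: w. Qed.
Lemma ReN z : complex.Re (- z) = - complex.Re z. Proof. by case: z. Qed.
Lemma ImN z : complex.Im (- z) = - complex.Im z. Proof. by case: z. Qed.
Lemma ReM z w : complex.Re (z * w) =
  complex.Re z * complex.Re w - complex.Im z * complex.Im w.
Proof. by case: z; case: w. Qed.
Lemma ImM z w : complex.Im (z * w) =
  complex.Re z * complex.Im w + complex.Im z * complex.Re w.
Proof. by case: z; case: w. Qed.
Lemma Re_conj z : complex.Re z^* = complex.Re z. Proof. by case: z. Qed.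
Lemma Im_conj z : complex.Im z^* = - complex.Im z. Proof. by case: z. Qed.
Lemma Re_inv z : complex.Re z^-1 = complex.Re z / normc z ^+ 2.
Proof. by rewrite normc_sqr; case: z. Qed.
Lemma Im_inv z : complex.Im z^-1 = - (complex.Im z / normc z ^+ 2).
Proof. by rewrite normc_sqr; case: z. Qed.

Lemma conjcD z w : (z + w)^* = z^* + w^*.
Proof. exact: (rmorphD (@conjc R)). Qed.
Lemma conjcM z w : (z * w)^* = z^* * w^*.
Proof. exact: (rmorphM (@conjc R)). Qed.
Lemma conjcN z : (- z)^* = - z^*.
Proof. exact: (rmorphN (@conjc R)). Qed.
Lemma conjc_sum (I : Type) (r : seq I) (F : I -> R[i]) :
  (\sum_(i <- r) F i)^* = \sum_(i <- r) conjc (F i).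
Proof. exact: (big_morph _ conjcD (@conjc0 _)). Qed.

Definition ReImE := (ReD, ImD, ReN, ImN, ReM, ImM, Re_conj, Im_conj).

Lemma normc_sum (I : Type) (r : seq I) (F : I -> R[i]) :
  normc (\sum_(i <- r) F i) <= \sum_(i <- r) normc (F i).
Proof.
elim: r => [|i r IH]; first by rewrite !big_nil normc_0.
by rewrite !big_cons (le_trans (normc_add _ _))// lerD2l.
Qed.

Lemma Re_sum (I : Type) (r : seq I) (P : pred I) (F : I -> R[i]) :
  complex.Re (\sum_(i <- r | P i) F i) = \sum_(i <- r | P i) complex.Re (F i).
Proof. exact: (big_morph _ ReD). Qed.

Lemma Im_sum (I : Type) (r : seq I) (P : pred I) (F : I -> R[i]) :
  complex.Im (\sum_(i <- r | P i) F i) = \sum_(i <- r | P i) complex.Im (F i).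
Proof. exact: (big_morph _ ImD). Qed.

End ComplexModulus.

Local Open Scope sesquilinear_scope.
Local Open Scope complex_scope.

(** * Hermitian products and resolvents *)

Section HermitianSpace.
Context {R : realType} (n : nat).
Implicit Types (u v w : 'cV[R[i]]_n) (A : 'M[R[i]]_n) (k : R[i]).

Definition dot u v : R[i] := \sum_i conjc (u i 0) * v i 0.
Definition normsq u : R := \sum_i normc (u i 0) ^+ 2.

Lemma dotE u v : dot u v = (u ^t* *m v) 0 0.
Proof. by rewrite mxE; apply: eq_bigr => i _; rewrite !mxE. Qed.

Lemma dotDr u v w : dot u (v + w) = dot u v + dot u w.
Proof. by rewrite -big_split; apply: eq_bigr => i _; rewrite mxE mulrDr. Qed.

Lemma dotZr k u v : dot u (k *: v) = k * dot u v.
Proof. by rewrite /dot mulr_sumr; apply: eq_bigr => i _; rewrite mxE mulrCA. Qed.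

Lemma dotNr u v : dot u (- v) = - dot u v.
Proof. by rewrite -scaleN1r dotZr mulN1r. Qed.

Lemma dotC u v : dot u v = (dot v u)^*.
Proof.
rewrite /dot conjc_sum; apply: eq_bigr => i _.
by rewrite conjcM conjcK mulrC.
Qed.

Lemma dotDl u v w : dot (u + v) w = dot u w + dot v w.
Proof. by rewrite dotC dotDr conjcD -!dotC. Qed.

Lemma dotZl k u v : dot (k *: u) v = k^* * dot u v.
Proof. by rewrite dotC dotZr conjcM -dotC. Qed.

Lemma dotNl u v : dot (- u) v = - dot u v.
Proof. by rewrite dotC dotNr conjcN -dotC. Qed.

Definition dot_lin := (dotDr, dotDl, dotNr, dotNl, dotZr, dotZl).

Lemma dot_normsq u : dot u u = (normsq u)%:C.
Proof.
rewrite /normsq raddf_sum; apply: eq_bigr => i _; exact: conj_mul.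
Qed.

Lemma normsq_ge0 u : 0 <= normsq u.
Proof. by apply: sumr_ge0 => i _; rewrite sqr_ge0. Qed.

Lemma normsq_Re u : normsq u = complex.Re (dot u u).
Proof. by rewrite dot_normsq. Qed.

Lemma normsq0_eq0 u : normsq u = 0 -> u = 0.
Proof.
move=> /eqP; rewrite psumr_eq0 => [/allP u0|i _]; last by rewrite sqr_ge0.
apply/matrixP => i j; rewrite ord1 mxE; apply/eqP.
by rewrite -normc_eq0 -sqrf_eq0; apply: u0; rewrite mem_index_enum.
Qed.

Lemma normsqD u v :
  normsq (u + v) = normsq u + normsq v + complex.Re (dot u v) *+ 2.
Proof.
rewrite !normsq_Re !dot_lin !ReImE (dotC v u) Re_conj; ring.
Qed.

Lemma normsqN u : normsq (- u) = normsq u.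
Proof. by rewrite !normsq_Re dotNl dotNr opprK. Qed.

Lemma normsqZ k u : normsq (k *: u) = normc k ^+ 2 * normsq u.
Proof.
by rewrite !normsq_Re dotZl dotZr mulrA conj_mul dot_normsq ReM /= mul0r subr0.
Qed.

(** Nonnegativity of the square of [|u|^2 v - (u, v) u]. *)
Lemma cauchy_schwarz u v : normc (dot u v) ^+ 2 <= normsq u * normsq v.
Proof.
have [/normsq0_eq0 ->|u0] := eqVneq (normsq u) 0.
  have -> : dot 0 v = 0 by rewrite -(scale0r v) dotZl conjc0 mul0r.
  by rewrite normc_0 expr0n mulr_ge0// normsq_ge0.
have up : 0 < normsq u by rewrite lt_def u0 normsq_ge0.
have := normsq_ge0 ((normsq u)%:C *: v - dot u v *: u).
rewrite normsqD normsqN !normsqZ !dot_lin (dotC v u) normc_real.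
rewrite real_normK ?num_real// !ReImE /= normc_sqr.
set x := complex.Re (dot u v); set y := complex.Im (dot u v).
move=> h; rewrite -(ler_pM2l up) -subr_ge0; apply: le_trans h _.
by rewrite le_eqVlt; apply/orP; left; apply/eqP; ring.
Qed.

Lemma normsqD_le u v : normsq (u + v) <= normsq u *+ 2 + normsq v *+ 2.
Proof.
have := normsq_ge0 (u - v); rewrite !normsqD normsqN dotNr ReN !mulr2n; lra.
Qed.

Lemma hermitian_adjoint A : A \is hermsymmx -> A ^t* = A.
Proof. by move=> /is_hermitianmxP hA; rewrite {2}hA expr0 scale1r. Qed.

Lemma dot_hermitian A u v : A \is hermsymmx -> dot u (A *m v) = dot (A *m u) v.
Proof.
move=> hA; rewrite !dotE trmx_mul map_mxM /= -[in LHS](hermitian_adjoint hA).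
by rewrite mulmxA.
Qed.

Lemma Im_dot_hermitian A u : A \is hermsymmx -> complex.Im (dot u (A *m u)) = 0.
Proof.
move=> hA; have /(congr1 (fun z => complex.Im z)) := dotC u (A *m u).
by rewrite -dot_hermitian// Im_conj; lra.
Qed.

End HermitianSpace.

Section Resolvent.
Context {R : realType} (n : nat).
Variables (C : 'M[R[i]]_n) (z : R[i]).
Hypotheses (hC : C \is hermsymmx) (hz : 0 < complex.Im z).

Definition resolvent (D : 'M[R[i]]_n) (w : R[i]) := invmx (D - w%:M).

(** The real part of the shift only adds to the norm: write [C - z] as the
    hermitian matrix [C - Re z] minus [i Im z], whose cross term is imaginary. *)
Lemma hermitian_shift_lower (u : 'cV[R[i]]_n) :
  complex.Im z ^+ 2 * normsq u <= normsq ((C - z%:M) *m u).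
Proof.
rewrite mulmxBl mul_scalar_mx normsqD normsqN normsqZ normc_sqr.
rewrite dotNr dotZr ReN ReM -dot_hermitian// Im_dot_hermitian// mulr0 subr0.
have : 0 <= normsq (C *m u - (complex.Re z)%:C *: u) by exact: normsq_ge0.
rewrite normsqD normsqN normsqZ dotNr dotZr ReN ReM -dot_hermitian//.
rewrite Im_dot_hermitian// mulr0 subr0 normc_real real_normK ?num_real//=.
rewrite !mulr2n; nra.
Qed.

Lemma resolvent_unit : C - z%:M \in unitmx.
Proof.
rewrite -unitmx_tr -row_free_unit -kermx_eq0.
apply/rowV0P => v /sub_kermxP /(congr1 trmx).
rewrite trmx_mul trmxK trmx0 => h.
have := hermitian_shift_lower v^T; rewrite h.
have -> : normsq (0 : 'cV[R[i]]_n) = 0.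
  by rewrite -(scale0r (0 : 'cV[R[i]]_n)) normsqZ normc_0 expr0n mul0r.
move=> le0; have v0 : normsq v^T = 0.
  apply/eqP; rewrite eq_le normsq_ge0 andbT.
  by rewrite -(@ler_pM2l _ (complex.Im z ^+ 2)) ?exprn_gt0// mulr0.
by rewrite -[v]trmxK (normsq0_eq0 v0) trmx0.
Qed.

Lemma resolventK (u : 'cV[R[i]]_n) : (C - z%:M) *m (resolvent C z *m u) = u.
Proof. by rewrite mulmxA mulmxV ?mul1mx// resolvent_unit. Qed.

(** The way resolvents are computed below: guess the solution and check it. *)
Lemma resolvent_eq (u v : 'cV[R[i]]_n) :
  C *m v - z *: v = u -> resolvent C z *m u = v.
Proof.
by move=> <-; rewrite -mul_scalar_mx -mulmxBl mulKmx// resolvent_unit.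
Qed.

Lemma normsq_resolvent (u : 'cV[R[i]]_n) :
  complex.Im z ^+ 2 * normsq (resolvent C z *m u) <= normsq u.
Proof.
by rewrite -{2}(resolventK u); exact: hermitian_shift_lower.
Qed.

End Resolvent.

(** * The Schur function and its factorization *)

Section NonpositiveEigenvalue.
Context {R : realType} (n : nat).
Variables (a : R) (b : 'cV[R[i]]_n) (C : 'M[R[i]]_n).

(** The Schur complement of [C - z] in the bordered matrix minus [z]; its zeros
    off the spectrum of [C] are the eigenvalues of the bordered matrix. *)
Definition schur_function (z : R[i]) : R[i] :=
  a%:C - z + dot b (resolvent C z *m b).

(** The eigenvalue equations for an eigenvector of the form [(1, u)]. *)
Definition nonpositive_solution (u : 'cV[R[i]]_n) (beta : R[i]) : Prop :=
  [/\ 0 <= complex.Im beta, b + C *m u = beta *: u, a%:C - dot b u = beta &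
      normsq u <= 1].

(** The first coordinate of an eigenvector of nonpositive type is nonzero,
    since its modulus dominates the norm of the other coordinates. *)
Lemma nonpositive_type_solution beta :
  nonpositive_type_eigenvalue (pontryagin_mx n) (bordered_mx a b C) beta ->
  exists u, nonpositive_solution u beta.
Proof.
case=> Im0 [x [x0 eigx negx]].
move: x0 eigx negx; rewrite -[x]vsubmxK.
set x1 := usubmx x; set x2 := dsubmx x.
rewrite /bordered_mx /pontryagin_mx mul_block_col scale_col_mx.
move=> x0 /eq_col_mx[e1 e2].
set t := x1 0 0.
have x1E : x1 = t%:M by rewrite [LHS]mx11_scalar.
have -> : indef_form (block_mx (-1)%:M 0 0 1%:M) (col_mx x1 x2)
   (col_mx x1 x2) = (normsq x2 - normc t ^+ 2)%:C.
  rewrite /indef_form -mulmxA mul_block_col !mul0mx addr0 add0r mul1mx.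
  rewrite tr_col_mx map_row_mx mul_row_col mxE -!dotE mul_scalar_mx dotZr.
  rewrite !dot_normsq [normsq x1]big_ord1 -/t mulN1r addrC.
  by rewrite (rmorphB (real_complex R)).
rewrite lecR subr_le0 => negx.
have t0 : t != 0.
  apply: contra_neq x0 => t0; rewrite x1E t0.
  have -> : x2 = 0.
    apply: normsq0_eq0; apply/eqP; rewrite eq_le normsq_ge0 andbT.
    by rewrite (le_trans negx)// t0 normc_0 expr0n.
  by rewrite -(col_mx0 _ 1 n 1); congr col_mx; apply/matrixP => i j; rewrite !mxE mul0rn.
exists (t^-1 *: x2); split => //.
- have := congr1 (fun v => t^-1 *: v) e2.
  rewrite /= x1E mul_mx_scalar scalerDr !scalerA mulVf// scale1r => h.
  by rewrite -scalemxAr h mulrC.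
- rewrite dotZr.
  have := congr1 (fun M : 'M[R[i]]_(1, 1) => M 0 0) e1.
  rewrite /= mul_scalar_mx mulNmx mxE [X in X + _]mxE [X in _ + X]mxE -dotE.
  rewrite [RHS]mxE -/t => h.
  have <- : t^-1 * (beta * t) = beta by rewrite mulrC mulfK.
  by rewrite -h mulrBr [a%:C * t]mulrC mulKf.
- rewrite normsqZ normc_inv exprVn mulrC ler_pdivrMr ?mul1r//.
  by rewrite exprn_gt0// lt_def normc_ge0 normc_eq0 t0.
Qed.

Variables (u : 'cV[R[i]]_n) (beta : R[i]).
Hypotheses (hC : C \is hermsymmx) (hu : nonpositive_solution u beta).

Lemma nonpositive_solution_b : b = beta *: u - C *m u.
Proof. by case: hu => _ <- _ _; rewrite addrK. Qed.

(** Eigenvectors of a nonreal eigenvalue are neutral for the indefinite form: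
    compare imaginary parts in [a - b^* u = beta], where [b = beta u - C u]. *)
Lemma nonpositive_solution_neutral : complex.Im beta * (1 - normsq u) = 0.
Proof.
have [_ _ hb _] := hu; have := congr1 (fun z => complex.Im z) hb.
rewrite /= nonpositive_solution_b dotDl dotZl dotNl dot_normsq.
rewrite -dot_hermitian// !ReImE Im_dot_hermitian//= => h.
rewrite mulrBr mulr1 -{1}h; ring.
Qed.

Lemma normc_beta B : `|a| <= B -> normsq b <= B ^+ 2 -> normc beta <= B *+ 2.
Proof.
have [_ _ <- u1] := hu => aB bB.
have B0 : 0 <= B by exact: le_trans aB.
rewrite (le_trans (normc_sub _ _))// mulr2n lerD ?normc_real//.
rewrite -(@ler_pXn2r _ 2) ?nnegrE ?normc_ge0//.
rewrite (le_trans (cauchy_schwarz _ _))// (le_trans _ bB)//.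
by rewrite ler_piMr// normsq_ge0.
Qed.

Variable z : R[i].
Hypothesis hz : 0 < complex.Im z.

(** The Stieltjes transform of the probability measure described at the top. *)
Definition spectral_transform : R[i] :=
  dot u (resolvent C z *m u) + (normsq u - 1)%:C / (z - beta^*).

Lemma Im_sub_conj_gt0 : 0 < complex.Im (z - beta^*).
Proof.
by have [Ib _ _ _] := hu; rewrite !ReImE; move: Ib hz; lra.
Qed.

Lemma normc_sub_conj_gt0 : 0 < normc (z - beta^*).
Proof.
rewrite lt_def normc_ge0 normc_eq0 andbT; apply/eqP => h.
by have := Im_sub_conj_gt0; rewrite h ltxx.
Qed.

Lemma sub_conj_neq0 : z - beta^* != 0.
Proof. by rewrite -normc_eq0 gt_eqF// normc_sub_conj_gt0. Qed.

(** With [v = R u] one has [R b = - (u + (z - beta) v)], and every term of the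
    Schur function becomes a polynomial in [z], [beta], [|u|^2] and [u^* v]. *)
Lemma schur_factor :
  schur_function z = (z - beta) * (z - beta^*) * spectral_transform.
Proof.
have [_ _ hb _] := hu.
set v := resolvent C z *m u.
have hv : C *m v - z *: v = u.
  by rewrite -mul_scalar_mx -mulmxBl resolventK.
have Rb : resolvent C z *m b = - (u + (z - beta) *: v).
  apply: resolvent_eq => //.
  rewrite mulmxN mulmxDr -scalemxAr scalerN opprK.
  have -> : C *m v = u + z *: v by rewrite -{1}hv subrK.
  rewrite nonpositive_solution_b; move: (C *m u) => Cu.
  apply/matrixP => i j; rewrite !mxE; ring.
have dbv : dot b v = (beta^* - z) * dot u v - (normsq u)%:C.
  rewrite nonpositive_solution_b dotDl dotZl dotNl -dot_hermitian//.
  have -> : C *m v = u + z *: v by rewrite -{1}hv subrK.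
  by rewrite dotDr dotZr dot_normsq; ring.
have sE : (z - beta^*) * spectral_transform =
    (z - beta^*) * dot u v + ((normsq u)%:C - 1).
  rewrite /spectral_transform mulrDr mulrCA mulfV ?sub_conj_neq0// mulr1.
  by rewrite (rmorphB (real_complex R)).
have aE : a%:C = beta + dot b u by rewrite -hb subrK.
by rewrite -mulrA sE /schur_function Rb dotNr dotDr dotZr dbv aE; ring.
Qed.

(** With [p = |u|^2] the imaginary part is
    [Im z (|R u|^2 + (1 - p) / |z - beta^*|^2)].  Since [(C - z^* ) u] equals
    [(beta - z^* ) u - b], Cauchy-Schwarz bounds [p^2] by [|R u|^2] times the
    denominator of the statement; the constant is the minimum [3 / 4] of
    [p^2 + 1 - p]. *)
Lemma Im_spectral_transform :
  complex.Im z * (3 / 4 / (normc (z - beta^*) ^+ 2 *+ 2 + normsq b *+ 2))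
    <= complex.Im spectral_transform.
Proof.
have [Ib _ hb u1] := hu.
set v := resolvent C z *m u.
have hv : u = C *m v - z *: v.
  by rewrite -mul_scalar_mx -mulmxBl resolventK.
set D := normc (z - beta^*) ^+ 2; set K := D *+ 2 + _.
have D0 : 0 < D by rewrite exprn_gt0// normc_sub_conj_gt0.
have b0 := normsq_ge0 b.
have DK : D <= K by rewrite /K !mulr2n; lra.
have K0 : 0 < K by exact: lt_le_trans DK.
have u0 := normsq_ge0 u.
have Imuv : complex.Im (dot u v) = complex.Im z * normsq v.
  rewrite {1}hv dotDl dotNl dotZl dot_normsq -dot_hermitian//.
  by rewrite !ReImE Im_dot_hermitian//=; ring.
have uv : normsq u ^+ 2 <= normsq v * K.
  have -> : normsq u ^+ 2 = normc (dot u u) ^+ 2.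
    by rewrite dot_normsq normc_real ger0_norm.
  rewrite {2}hv dotDr dotNr dotZr dot_hermitian//.
  have -> : dot (C *m u) v - z * dot u v = dot ((beta - z^*) *: u - b) v.
    rewrite nonpositive_solution_b !dot_lin conjcD conjcN conjcK; ring.
  rewrite mulrC (le_trans (cauchy_schwarz _ _))// ler_wpM2r ?normsq_ge0//.
  rewrite (le_trans (normsqD_le _ _))// normsqN normsqZ lerD2r lerMn2r /=.
  have -> : normc (beta - z^*) = normc (z - beta^*).
    by rewrite -normc_conj conjcD conjcN conjcK normc_subC.
  by rewrite -/D ler_piMr// ltW.
rewrite /spectral_transform -/v ImD Imuv.
have -> : complex.Im ((normsq u - 1)%:C / (z - beta^*)) =
          complex.Im z * ((1 - normsq u) / D).
  rewrite ImM /= mul0r addr0 Im_inv -/D !ReImE.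
  have := nonpositive_solution_neutral.
  set y := complex.Im z; set x := complex.Im beta => h.
  rewrite [RHS]mulrA; have -> : y * (1 - normsq u) = (y + x) * (1 - normsq u).
    by rewrite mulrDl h addr0.
  rewrite opprK; ring.
rewrite -mulrDr ler_pM2l// ler_pdivrMr// mulrDl.
have : (1 - normsq u) / D * K >= 1 - normsq u.
  by rewrite mulrAC -mulrA ler_peMr ?subr_ge0// ler_pdivlMr// mul1r.
have := sqr_ge0 (normsq u - 2^-1).
move: uv; rewrite !expr2; set p := normsq u; lra.
Qed.

Lemma normc_sub_le_conj : normc (z - beta) <= normc (z - beta^*).
Proof.
have [Ib _ _ _] := hu.
rewrite -(@ler_pXn2r _ 2) ?nnegrE ?normc_ge0// !normc_sqr !ReImE.
by move: Ib hz; set y := complex.Im z; set x := complex.Im beta; nra.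
Qed.

End NonpositiveEigenvalue.

(** * Stability of the generalized zero of nonpositive type *)

Section Stability.
Context {R : realType}.

(** A finite form of continuity of the eigenvalue in the Schur function: what
    matters is that [z] and [delta] do not depend on the size of the matrix. *)
Definition gznt_stable (Q0 : R[i] -> R[i]) (beta0 : R[i]) : Prop :=
  forall B eps : R, 0 < B -> 0 < eps ->
  exists z delta, [/\ 0 < complex.Im z, 0 < delta &
    forall n a (b : 'cV[R[i]]_n) C u beta, C \is hermsymmx ->
      nonpositive_solution a b C u beta ->
      `|a| <= B -> normsq b <= B ^+ 2 ->
      normc (schur_function a b C z - Q0 z) <= delta -> normc (beta - beta0) <= eps].

Lemma spectral_transform_lower n (a : R) (b : 'cV[R[i]]_n) C u beta z B M :
  C \is hermsymmx -> nonpositive_solution a b C u beta ->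
  `|a| <= B -> normsq b <= B ^+ 2 -> 0 < complex.Im z -> normc z <= M ->
  complex.Im z * (3 / 4 / ((M + B *+ 2) ^+ 2 *+ 2 + B ^+ 2 *+ 2))
    <= complex.Im (spectral_transform C u beta z).
Proof.
move=> hC hu aB bB hz zM; apply: le_trans (Im_spectral_transform hC hu hz).
rewrite ler_pM2l// ler_pM2l; last by rewrite divr_gt0.
have c0 := normc_sub_conj_gt0 hu hz.
have cM : normc (z - beta^*) <= M + B *+ 2.
  rewrite (le_trans (normc_sub _ _))// normc_conj lerD//.
  exact: normc_beta hu _ aB bB.
have D0 : 0 < normc (z - beta^*) ^+ 2 by rewrite exprn_gt0.
have DM : normc (z - beta^*) ^+ 2 <= (M + B *+ 2) ^+ 2.
  by rewrite ler_pXn2r// nnegrE ltW// (lt_le_trans c0).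
have b0 := normsq_ge0 b.
by rewrite lef_pV2 ?posrE !mulr2n; move: D0 DM b0 bB; lra.
Qed.

(** The factor [S] is bounded below at [beta0] itself, and the other two factors
    are at least the distance from [beta0] to [beta]. *)
Lemma gznt_stable_upper Q0 beta0 : 0 < complex.Im beta0 -> Q0 beta0 = 0 ->
  gznt_stable Q0 beta0.
Proof.
move=> h0 Q00 B eps B0 eps0.
set M := normc beta0.
set c := complex.Im beta0 * (3 / 4 / ((M + B *+ 2) ^+ 2 *+ 2 + B ^+ 2 *+ 2)).
have c0 : 0 < c.
  rewrite mulr_gt0// divr_gt0// ?divr_gt0//.
  have := exprn_gt0 2 B0; have := sqr_ge0 (M + B *+ 2); rewrite !mulr2n; lra.
exists beta0, (c * eps ^+ 2); split => //; first by rewrite mulr_gt0 ?exprn_gt0.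
move=> n a b C u beta hC hu aB bB; rewrite Q00 subr0 => hQ.
have cS := spectral_transform_lower hC hu aB bB h0 (lexx _).
rewrite -/M -/c in cS.
rewrite leNgt; apply/negP => far.
suff : c * eps ^+ 2 < normc (schur_function a b C beta0) by rewrite ltNge hQ.
rewrite (schur_factor hC hu h0) !normc_mul mulrC expr2.
have far1 : eps < normc (beta0 - beta) by rewrite normc_subC.
have far2 : eps < normc (beta0 - beta^*).
  exact: lt_le_trans far1 (normc_sub_le_conj hu h0).
have cS' : c <= normc (spectral_transform C u beta beta0).
  by rewrite (le_trans cS)// (le_trans (ler_norm _))// Im_le_normc.
apply: (@lt_le_trans _ _ (normc (beta0 - beta) * normc (beta0 - beta^*) * c)).
  by rewrite ltr_pM2r// ltr_pM// ltW.
by rewrite ler_wpM2l// mulr_ge0// normc_ge0.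
Qed.

(** The vertical half-line lies in every Stolz sector, and is all that is needed
    of the nontangential limit. *)
Lemma gznt_vertical theta (Q0 : R[i] -> R[i]) beta0 (L eta rho : R) :
  0 < theta < pi / 2 -> 
  (fun z : R[i]^o => Q0 z / (z - beta0) : R[i]^o)
       @ within (stolz_sector theta beta0) (nbhs (beta0 : R[i]^o))
       --> (L%:C : R[i]^o) ->
  complex.Im beta0 = 0 -> 0 < eta -> 0 < rho ->
  exists y : R, [/\ 0 < y, y <= rho &
    normc (Q0 (beta0 + (0 +i* y)) / (0 +i* y) - L%:C) <= eta].
Proof.
move=> /andP[th0 _] /cvgrPdist_le /(_ eta%:C) + Im0 eta0 rho0.
rewrite ltcR => /(_ eta0).
rewrite near_withinE => /nbhs_ballP[[r ri] /=].
rewrite ltcE /= => /andP[/eqP ri0 r0]; subst ri.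
move=> near.
exists (Order.min rho (r / 2)); set y := Order.min _ _.
have y0 : 0 < y by rewrite lt_min rho0 divr_gt0.
have yr : y < r by rewrite gt_min ltr_pdivrMr// ltr_pMr// ltr1n orbT.
split => //; first by rewrite ge_min lexx.
set z : R[i] := beta0 + (0 +i* y).
have zb : z - beta0 = 0 +i* y by rewrite /z addrC addKr.
have nyi : normc (0 +i* y) = y by rewrite /= expr0n add0r sqrtr_sqr gtr0_norm.
have /near : ball (beta0 : R[i]^o) r%:C (z : R[i]^o).
  rewrite -ball_normE /= -[X in (X < _)%R]/((normc (beta0 - z))%:C) ltcR.
  by rewrite normc_subC zb nyi.
have zS : stolz_sector theta beta0 z.
  split; first by rewrite ImD Im0 add0r.
  exists y, (pi / 2); split => //.
    by rewrite gerBl ltW//= lerDl ltW.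
  by rewrite zb cos_pihalf sin_pihalf; simpc.
move=> /(_ zS).
rewrite -[X in (X <= _)%R]/((normc (L%:C - Q0 z / (z - beta0)))%:C) lecR.
by rewrite normc_subC zb.
Qed.

(** Let [d = beta0 - beta], [z = beta0 + i y].  Then [Q(z)] equals
    [(|d|^2 - y^2 + 2 i y Re d) S(z)].  If [|d| > eps], then [|S(z)|] is at most
    [t y] because [|Q(z)|] is at most [(1 - L) y], so [Im Q(z)] is [|d|^2 Im S(z)] up
    to [O(y^2)], hence at least [3 / 4] of [c eps^2 y]; but it is at most [1 / 4] of
    it, since [Q(z) / (i y)] is close to [L <= 0]. *)
Lemma gznt_stable_real theta Q0 beta0 (L : R) : 0 < theta < pi / 2 ->
  complex.Im beta0 = 0 -> L <= 0 -> 
  (fun z : R[i]^o => Q0 z / (z - beta0) : R[i]^o)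
       @ within (stolz_sector theta beta0) (nbhs (beta0 : R[i]^o))
       --> (L%:C : R[i]^o) -> gznt_stable Q0 beta0.
Proof.
move=> hth Im0 L0 hlim B eps B0 eps0.
set M := normc beta0 + 1.
set c := 3 / 4 / ((M + B *+ 2) ^+ 2 *+ 2 + B ^+ 2 *+ 2).
have c0 : 0 < c.
  rewrite divr_gt0// ?divr_gt0//.
  have := exprn_gt0 2 B0; have := sqr_ge0 (M + B *+ 2); rewrite !mulr2n; lra.
set E := normc beta0 + B *+ 2.
have E0 : 0 < E by rewrite ltr_wpDl ?normc_ge0// mulrn_wgt0.
have e2 : 0 < eps ^+ 2 by rewrite exprn_gt0.
have ce2 : 0 < c * eps ^+ 2 by rewrite mulr_gt0.
set t := 2 * (1 - L) / eps ^+ 2.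
have L1 : 0 < 1 - L by rewrite subr_gt0 (le_lt_trans L0).
have t0 : 0 < t by rewrite divr_gt0// mulr_gt0.
set eta := Order.min (1 / 2) (c * eps ^+ 2 / 8).
have eta0 : 0 < eta by rewrite lt_min divr_gt0//= divr_gt0.
have eta1 : eta <= 1 / 2 by rewrite ge_min lexx.
have eta2 : eta <= c * eps ^+ 2 / 8 by rewrite ge_min lexx orbT.
set kap := Order.min (eps ^+ 2 / 2) (c * eps ^+ 2 / (4 * t)).
have kap0 : 0 < kap by rewrite lt_min divr_gt0//= divr_gt0// mulr_gt0.
have kap1 : kap <= eps ^+ 2 / 2 by rewrite ge_min lexx.
have kap2 : t * kap <= c * eps ^+ 2 / 4.
  have : kap <= c * eps ^+ 2 / (4 * t) by rewrite ge_min lexx orbT.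
  rewrite -(ler_pM2l t0) => /le_trans; apply.
  rewrite le_eqVlt; apply/orP; left; apply/eqP; field.
  by rewrite gt_eqF.
set rho := Order.min 1 (kap / (1 + E *+ 2)).
have E1 : 0 < 1 + E *+ 2 by rewrite addr_gt0// mulrn_wgt0.
have rho0 : 0 < rho by rewrite lt_min ltr01 divr_gt0.
have [y [y0 yrho hy]] := gznt_vertical hth hlim Im0 eta0 rho0.
have y1 : y <= 1 by rewrite (le_trans yrho)// ge_min lexx.
have ykap : y * (1 + E *+ 2) <= kap.
  by rewrite -ler_pdivlMr// (le_trans yrho)// ge_min lexx orbT.
set z := beta0 + (0 +i* y) in hy *.
have Imz : complex.Im z = y by rewrite ImD Im0 add0r.
exists z, (eta * y); split; [by rewrite Imz| by rewrite mulr_gt0|].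
move=> n a b C u beta hC hu aB bB hQ.
have hz : 0 < complex.Im z by rewrite Imz.
have zM : normc z <= M.
  by rewrite (le_trans (normc_add _ _))// lerD2l /= expr0n add0r sqrtr_sqr gtr0_norm.
have := spectral_transform_lower hC hu aB bB hz zM; rewrite -/c Imz => cS.
rewrite leNgt; apply/negP => far.
set Q := schur_function a b C z in hQ *.
set S := spectral_transform C u beta z in cS *.
set d := beta0 - beta.
have dE : normc d <= E.
  by rewrite (le_trans (normc_sub _ _))// lerD2l (normc_beta hu aB bB).
have dfar : eps ^+ 2 < normc d ^+ 2.
  by rewrite ltr_pXn2r ?nnegrE ?normc_ge0 ?ltW// /d normc_subC.
have QE : Q = ((normc d ^+ 2 - y ^+ 2) +i* (2 * y * complex.Re d)) * S.
  rewrite /Q (schur_factor hC hu hz) -/S; congr (_ * _).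
  rewrite normc_sqr /z /d; move: Im0; clear.
  case: beta0 => p0 q0 /= ->; case: beta => p q; simpc.
  by congr (_ +i* _) => /=; ring.
have iyQ : normc (Q - (0 +i* y) * L%:C) <= 2 * eta * y.
  rewrite -[X in normc X](subrKA (Q0 z)) (le_trans (normc_add _ _))//.
  rewrite -mulrA mulr_natl mulr2n lerD//.
  have -> : Q0 z - (0 +i* y) * L%:C = (0 +i* y) * (Q0 z / (0 +i* y) - L%:C).
    rewrite mulrBr mulrCA mulfV ?mulr1// eq_complex /= eqxx /=.
    by rewrite gt_eqF.
  rewrite normc_mul mulrC /= expr0n add0r sqrtr_sqr gtr0_norm//.
  by rewrite ler_pM2r.
have ImQ : complex.Im Q <= c * eps ^+ 2 / 4 * y.
  have := le_trans (ler_norm _) (le_trans (Im_le_normc _) iyQ).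
  rewrite !ReImE /= => h.
  have := ler_wpM2r (ltW y0) eta2; have := ler_wpM2r (ltW y0) L0.
  by move: h; lra.
have nQ : normc Q <= (1 - L) * y.
  rewrite -[Q](subrK ((0 +i* y) * L%:C)) (le_trans (normc_add _ _))//.
  rewrite normc_mul normc_real /= expr0n add0r sqrtr_sqr gtr0_norm//.
  rewrite ler0_norm//; have := ler_wpM2r (ltW y0) eta1.
  by move: iyQ; lra.
have y2 : y ^+ 2 <= y * (1 + E *+ 2).
  by rewrite expr2 ler_pM2l// (le_trans y1)// lerDl mulrn_wge0// ltW.
have D1 : eps ^+ 2 / 2 <= normc d ^+ 2 - y ^+ 2.
  by move: y2 ykap kap1 dfar; lra.
have nS : normc S <= t * y.
  have : (eps ^+ 2 / 2) * normc S <= (1 - L) * y.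
    apply: le_trans nQ; rewrite QE normc_mul ler_wpM2r ?normc_ge0//.
    by rewrite (le_trans D1)// (le_trans (ler_norm _))// (le_trans _ (Re_le_normc _)).
  rewrite mulrC -ler_pdivlMr ?divr_gt0// => /le_trans; apply.
  by rewrite le_eqVlt /t; apply/orP; left; apply/eqP; field; rewrite gt_eqF.
have y20 : 0 <= y ^+ 2 by rewrite sqr_ge0.
have ImS : complex.Im S <= t * y.
  exact: le_trans (ler_norm _) (le_trans (Im_le_normc _) nS).
have ReS : `|2 * y * complex.Re d * complex.Re S| <= 2 * y * E * (t * y).
  rewrite 2!normrM (@gtr0_norm _ (2 * y)) ?mulr_gt0// -!(mulrA (2 * y)).
  rewrite ler_pM2l ?mulr_gt0// ler_pM ?normr_ge0//.
    exact: le_trans (Re_le_normc _) _.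
  exact: le_trans (Re_le_normc _) _.
have ReS' : - (2 * y * complex.Re d * complex.Re S) <= 2 * y * E * (t * y).
  by rewrite (le_trans (ler_norm _))// normrN.
have : y * (c * eps ^+ 2 - kap * t) <= complex.Im Q.
  rewrite QE ImM /=.
  have h1 : normc d ^+ 2 * complex.Im S >= eps ^+ 2 * (y * c).
    by rewrite ler_pM// ltW// mulr_gt0.
  have h2 : y ^+ 2 * complex.Im S <= y ^+ 2 * (t * y) by rewrite ler_wpM2l.
  have h3 : (y ^+ 2 + 2 * y * E) * (t * y) <= kap * (t * y).
    rewrite (ler_pM2r (mulr_gt0 t0 y0)) (le_trans _ ykap)//.
    rewrite (_ : y * (1 + E *+ 2) = y + 2 * y * E); last by ring.
    by rewrite lerD2r expr2 ler_piMr// ltW.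
  by move: h1 h2 h3 ReS'; lra.
rewrite leNgt => /negP; apply.
apply: le_lt_trans ImQ _; rewrite mulrC ltr_pM2l//.
by move: kap2 ce2; lra.
Qed.

Lemma gznt_is_stable theta Q0 beta0 : 0 < theta < pi / 2 ->
  gznt theta Q0 beta0 -> gznt_stable Q0 beta0.
Proof.
move=> hth [[h0 Q00]|[Im0 [L L0 hlim]]]; first exact: gznt_stable_upper.
exact: gznt_stable_real hth Im0 L0 hlim.
Qed.

End Stability.

(** * Approximate solutions of the eigenvalue equations *)

Section ApproximateSolutions.
Context {R : realType} (n : nat).
Variables (a : R) (b : 'cV[R[i]]_n) (C : 'M[R[i]]_n).

(** The value that the first eigenvalue equation assigns to [v], and the defect
    of [v] in the second one. *)
Definition solution_value (v : 'cV[R[i]]_n) : R[i] := a%:C - dot b v.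

Definition solution_residue (v : 'cV[R[i]]_n) : 'cV[R[i]]_n :=
  b + C *m v - solution_value v *: v.

Definition approx_solution (eta : R) (v : 'cV[R[i]]_n) : Prop :=
  [/\ normsq (solution_residue v) <= eta ^+ 4, normsq v <= 1 + eta &
      - eta <= complex.Im (solution_value v)].

Variables (u : 'cV[R[i]]_n) (beta : R[i]).
Hypotheses (hC : C \is hermsymmx) (hu : nonpositive_solution a b C u beta).

(** The symmetry of the bordered matrix for the indefinite form, applied to the
    exact solution [(1, u)] and to [(1, v)], gives
    [(beta - zeta^* ) (1 - v^* u) = - r^* u] with [zeta] the value and [r] the residue
    of [v].  So either [beta] is near [zeta^*], and then both are nearly real, or
    [v^* u] is near [1]; in that case [v] is near [u], both being of norm at most
    [1] up to [eta]. *)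
Lemma approx_solution_value eta v : 0 < eta -> approx_solution eta v ->
  normc (beta - solution_value v) ^+ 2
    <= 10 * eta ^+ 2 + 3 * eta * normsq b.
Proof.
move=> eta0 []; set r := solution_residue v; set zeta := solution_value v.
move=> hr hv hz; have [Ib hb ha u1] := hu.
have u0 := normsq_ge0 u; have v0 := normsq_ge0 v; have b0 := normsq_ge0 b.
have key : (beta - zeta^*) * (1 - dot v u) = - dot r u.
  have -> : dot r u = dot b u + dot (C *m v) u - zeta^* * dot v u.
    by rewrite /r /solution_residue dotDl dotNl dotZl -/zeta dotDl.
  have h1 : dot v b + dot (C *m v) u = beta * dot v u.
    by rewrite -dot_hermitian// -dotDr hb dotZr.
  have h2 : dot b u = a%:C - beta by rewrite -ha; ring.
  have h3 : dot v b = a%:C - zeta^*.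
    by rewrite /zeta /solution_value conjcD conjcN conjc_real -dotC; ring.
  have -> : dot (C *m v) u = beta * dot v u - (a%:C - zeta^*).
    by rewrite -h1 h3; ring.
  by rewrite h2; ring.
have nr : normc (beta - zeta^*) * normc (1 - dot v u) <= eta ^+ 2.
  rewrite -normc_mul key normc_opp -(@ler_pXn2r _ 2) ?nnegrE ?normc_ge0//;
    last by rewrite exprn_ge0// ltW.
  rewrite (le_trans (cauchy_schwarz _ _))// -exprM.
  by rewrite (le_trans _ hr)// ler_piMr// normsq_ge0.
have vu : normsq (v - u) <= eta + normc (1 - dot v u) *+ 2.
  rewrite normsqD normsqN dotNr ReN.
  have := le_trans (ler_norm _) (Re_le_normc (1 - dot v u)).
  by rewrite !ReImE /= !mulr2n; move: u1 hv; lra.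
have bz : normc (beta - zeta) ^+ 2 <= normsq b * normsq (v - u).
  have -> : beta - zeta = dot b (v - u).
    by rewrite -ha /zeta /solution_value dotDr dotNr; ring.
  exact: cauchy_schwarz.
clearbody zeta.
have [small|big] := leP (normc (1 - dot v u)) eta.
  rewrite (le_trans bz)//; apply: ler_wpDl; first by rewrite mulr_ge0 ?sqr_ge0.
  rewrite mulrC ler_wpM2r//.
  by rewrite (le_trans vu)// mulr2n; move: small; lra.
have bzc : normc (beta - zeta^*) <= eta.
  rewrite -(ler_pM2r eta0) -expr2 (le_trans _ nr)// ler_wpM2l ?normc_ge0//.
  exact: ltW.
have : `|complex.Re (beta - zeta)| <= eta.
  by have := le_trans (Re_le_normc _) bzc; rewrite !ReImE.
have : `|complex.Im (beta - zeta)| <= 3 * eta.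
  have := le_trans (Im_le_normc _) bzc; rewrite !ReImE !ler_norml.
  move: hz Ib eta0 => hz Ib eta0 /andP[h1 h2].
  by apply/andP; split; move: hz Ib eta0 h1 h2; lra.
have sq (x y : R) : `|x| <= y -> x ^+ 2 <= y ^+ 2.
  move=> xy; rewrite -real_normK ?num_real// ler_pXn2r// nnegrE//.
  exact: le_trans xy.
move=> /sq; rewrite exprMn => h1 /sq h2.
rewrite normc_sqr; have := mulr_ge0 (ltW eta0) b0.
by move: h1 h2; lra.
Qed.

Lemma normsq_mulmx (A : 'M[R[i]]_n) :
  exists2 K : R, 0 <= K & forall e, normsq (A *m e) <= K * normsq e.
Proof.
pose c i : 'cV[R[i]]_n := \col_j (A i j)^*.
exists (\sum_i normsq (c i)); first by apply: sumr_ge0 => i _; exact: normsq_ge0.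
move=> e; rewrite mulr_suml; apply: ler_sum => i _.
have -> : (A *m e) i 0 = dot (c i) e.
  by rewrite mxE; apply: eq_bigr => j _; rewrite mxE conjcK.
exact: cauchy_schwarz.
Qed.

(** The residue of [u + e] is [(C - beta) e + (b^* e) (u + e)], of norm [O(|e|)]. *)
Lemma approx_solution_near eta : 0 < eta ->
  exists2 delta : R, 0 < delta & forall v, normsq (v - u) <= delta ->
    approx_solution eta v /\ normc (beta - solution_value v) <= eta.
Proof.
move=> eta0; have [Ib hb ha u1] := hu.
have [K K0 hK] := normsq_mulmx C.
have b0 := normsq_ge0 b.
set A := 4 * K + 4 * normc beta ^+ 2 + 8 * normsq b.
have A0 : 0 <= A by rewrite !addr_ge0// mulr_ge0// sqr_ge0.
have A1 : 0 < A + 1 by rewrite ltr_wpDl.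
have bA : normsq b <= A.
  by rewrite /A; have := sqr_ge0 (normc beta); move: K0 b0; lra.
(* [k] bounds the norm of [v - u].  The bounds [1] and [eta / 3] are for the norm
   of [v], the other two for its residue and its value. *)
set k := Order.min (Order.min 1 (eta / 3))
  (Order.min (eta ^+ 2 / (A + 1)) (eta / (A + 1))).
have k0 : 0 < k by rewrite !lt_min ltr01 !divr_gt0// exprn_gt0.
have k1 : k <= 1 by rewrite !ge_min lexx.
have k2 : k <= eta / 3 by rewrite !ge_min lexx orbT.
have k3 : k * (A + 1) <= eta ^+ 2.
  by rewrite -ler_pdivlMr// !ge_min lexx !orbT.
have k4 : k * (A + 1) <= eta.
  by rewrite -ler_pdivlMr// !ge_min lexx !orbT.
exists (k ^+ 2); first by rewrite exprn_gt0.
move=> v; set e := v - u => es.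
have e0 := normsq_ge0 e.
have bound (x y : R) : 0 <= y -> k * (A + 1) <= y -> x <= A * k ^+ 2 -> x <= y ^+ 2.
  move=> y0 ky /le_trans; apply.
  apply: (@le_trans _ _ ((k * (A + 1)) ^+ 2)).
    rewrite exprMn mulrC ler_wpM2l ?sqr_ge0// expr2 mulrDl mul1r mulrDr mulr1.
    by have := mulr_ge0 A0 A0; lra.
  by rewrite ler_pXn2r// nnegrE// mulr_ge0// ltW.
have vE : v = u + e by rewrite /e addrC subrK.
have be2 : normc (dot b e) ^+ 2 <= normsq b * k ^+ 2.
  by rewrite (le_trans (cauchy_schwarz _ _))// ler_wpM2l.
have be : normc (dot b e) <= eta.
  rewrite -(@ler_pXn2r _ 2) ?nnegrE ?normc_ge0 ?(ltW eta0)//.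
  apply: bound => //; first exact: ltW.
  by rewrite (le_trans be2)// ler_wpM2r// sqr_ge0.
have zE : solution_value v = beta - dot b e.
  by rewrite /solution_value vE dotDr -ha; ring.
have nv : normsq v <= 1 + k *+ 3.
  rewrite vE normsqD.
  have : complex.Re (dot u e) <= k.
    rewrite (le_trans (ler_norm _))// (le_trans (Re_le_normc _))//.
    rewrite -(@ler_pXn2r _ 2) ?nnegrE ?normc_ge0 ?(ltW k0)//.
    by rewrite (le_trans (cauchy_schwarz _ _))// (le_trans _ es)// ler_piMl.
  have : k ^+ 2 <= k by rewrite expr2 ler_piMr// ltW.
  by move: es u1; lra.
split; last by rewrite zE opprB addrC subrK.
split.
- have -> : solution_residue v =
    (C *m e - beta *: e) + dot b e *: v.
    rewrite /solution_residue zE vE mulmxDr addrA hb; move: (C *m e) => Ce.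
    by apply/matrixP => i j; rewrite !mxE; ring.
  rewrite -[4%N]/(2 * 2)%N exprM; apply: bound => //; first by rewrite exprn_ge0// ltW.
  rewrite (le_trans (normsqD_le _ _))// normsqZ.
  have h1 := normsqD_le (C *m e) (- (beta *: e)).
  rewrite normsqN normsqZ in h1.
  have h2 := le_trans (hK e) (ler_wpM2l K0 es).
  have h3 := ler_wpM2l (sqr_ge0 (normc beta)) es.
  have h4 : normc (dot b e) ^+ 2 * normsq v <= normsq b * k ^+ 2 * 4.
    rewrite ler_pM ?sqr_ge0 ?normsq_ge0// (le_trans nv)//.
    by move: k1; lra.
  by rewrite /A; move: h1 h2 h3 h4; rewrite !mulr2n; lra.
- by rewrite (le_trans nv)// lerD2l -mulr_natr -ler_pdivlMr.
- rewrite zE !ReImE; have := le_trans (ler_norm _) (le_trans (Im_le_normc _) be).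
  by move: Ib; lra.
Qed.

End ApproximateSolutions.

Section RationalVectors.
Context {R : realType} (n : nat).

Definition rational_col (q : 'cV[(rat * rat)%type]_n) : 'cV[R[i]]_n :=
  \col_i (ratr (q i 0).1 +i* ratr (q i 0).2).

Lemma rational_col_dense (u : 'cV[R[i]]_n) (delta : R) : 0 < delta ->
  exists q, normsq (rational_col q - u) <= delta.
Proof.
move=> d0.
set k := Order.min 1 (delta / (2 * n.+1%:R)).
have k0 : 0 < k by rewrite lt_min ltr01 divr_gt0// mulr_gt0// ltr0n.
have approx (x : R) : exists q : rat, `|ratr q - x| <= k.
  have [|q] := @rat_in_itvoo R (x - k) (x + k).
    by rewrite ltrD2l gtrN.
  rewrite in_itv /= => /andP[h1 h2]; exists q.
  by rewrite ler_norml; apply/andP; split; move: h1 h2; lra.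
have /choice[f hf] (i : 'I_n) : exists q : rat * rat,
    `|ratr q.1 - complex.Re (u i 0)| <= k /\ `|ratr q.2 - complex.Im (u i 0)| <= k.
  have [q1 h1] := approx (complex.Re (u i 0)).
  by have [q2 h2] := approx (complex.Im (u i 0)); exists (q1, q2).
exists (\col_i f i).
apply: (@le_trans _ _ (\sum_(i < n) k *+ 2)).
  apply: ler_sum => i _; rewrite !mxE normc_sqr !ReImE /=.
  have [h1 h2] := hf i.
  have sq (x : R) : `|x| <= k -> x ^+ 2 <= k.
    move=> xk; rewrite -real_normK ?num_real// expr2.
    by rewrite (le_trans (ler_piMr _ _) xk)// (le_trans xk)// ge_min lexx.
  by rewrite mulr2n lerD// sq.
rewrite sumr_const card_ord -mulrnA -mulr_natr.
have : k <= delta / (2 * n.+1%:R) by rewrite ge_min lexx orbT.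
rewrite ler_pdivlMr ?mulr_gt0 ?ltr0n//; apply: le_trans.
by rewrite ler_pM2l// natrM ler_pM2l// ler_nat.
Qed.

End RationalVectors.

(** * Measurability of complex random variables and of the eigenvalue *)

Section ComplexMeasurability.
Context {R : realType} d (T : measurableType d).
Implicit Types f g : T -> R[i].

(** Both parts are measurable; unlike [complex_rv], this form is stable under the
    arithmetic of [R[i]] by the real-valued lemmas. *)
Definition cmeas f : Prop :=
  measurable_fun setT (fun w => complex.Re (f w)) /\
  measurable_fun setT (fun w => complex.Im (f w)).

Lemma complex_rvP f : complex_rv f <-> cmeas f.
Proof. exact: measurable_fun_pairP. Qed.

Lemma eq_cmeas f g : f =1 g -> cmeas f -> cmeas g.
Proof. by move=> /funext ->. Qed.

Lemma cmeas_cst z : cmeas (fun=> z).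
Proof. by split; exact: measurable_cst. Qed.

Lemma cmeas_real (f : T -> R) : measurable_fun setT f -> cmeas (fun w => (f w)%:C).
Proof. by split => //; exact: measurable_cst. Qed.

Lemma cmeasD f g : cmeas f -> cmeas g -> cmeas (fun w => f w + g w).
Proof.
move=> [f1 f2] [g1 g2]; split.
  under eq_fun do rewrite ReD; exact: measurable_funD.
under eq_fun do rewrite ImD; exact: measurable_funD.
Qed.

Lemma cmeasN f : cmeas f -> cmeas (fun w => - f w).
Proof.
move=> [f1 f2]; split.
  under eq_fun do rewrite ReN; exact: measurable_funN.
under eq_fun do rewrite ImN; exact: measurable_funN.
Qed.

Lemma cmeasB f g : cmeas f -> cmeas g -> cmeas (fun w => f w - g w).
Proof. by move=> mf mg; apply: cmeasD => //; exact: cmeasN. Qed.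

Lemma cmeasM f g : cmeas f -> cmeas g -> cmeas (fun w => f w * g w).
Proof.
move=> [f1 f2] [g1 g2]; split.
  under eq_fun do rewrite ReM.
  by apply: measurable_funB; exact: measurable_funM.
under eq_fun do rewrite ImM.
by apply: measurable_funD; exact: measurable_funM.
Qed.

Lemma cmeas_conj f : cmeas f -> cmeas (fun w => (f w)^*).
Proof.
move=> [f1 f2]; split.
  by under eq_fun do rewrite Re_conj.
under eq_fun do rewrite Im_conj; exact: measurable_funN.
Qed.

Lemma cmeas_normc_sqr f : cmeas f -> measurable_fun setT (fun w => normc (f w) ^+ 2).
Proof.
move=> [f1 f2]; under eq_fun do rewrite normc_sqr.
by apply: measurable_funD; exact: measurable_funX.
Qed.

Lemma cmeas_normc f : cmeas f -> measurable_fun setT (fun w => normc (f w)).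
Proof.
move=> /cmeas_normc_sqr mf.
have -> : (fun w => normc (f w)) = Num.sqrt \o (fun w => normc (f w) ^+ 2).
  by apply/funext => w /=; rewrite sqrtr_sqr ger0_norm ?normc_ge0.
apply: measurableT_comp => //.
by apply: continuous_measurable_fun; exact: sqrt_continuous.
Qed.

(** On nonnegative numbers inversion is the power [-1], also at [0]. *)
Lemma measurable_fun_inv_nneg (h : T -> R) : (forall w, 0 <= h w) ->
  measurable_fun setT h -> measurable_fun setT (fun w => (h w)^-1).
Proof.
move=> h0 mh.
have -> : (fun w => (h w)^-1) = (@powR R ^~ (-1)) \o h.
  by apply/funext => w /=; rewrite powR_inv1.
by apply: measurableT_comp => //; exact: measurable_powR.
Qed.

Lemma cmeasV f : cmeas f -> cmeas (fun w => (f w)^-1).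
Proof.
move=> mf; have mn : measurable_fun setT (fun w => (normc (f w) ^+ 2)^-1).
  apply: measurable_fun_inv_nneg; last exact: cmeas_normc_sqr.
  by move=> w; rewrite sqr_ge0.
case: mf => f1 f2; split.
  by under eq_fun do rewrite Re_inv; exact: measurable_funM.
under eq_fun do rewrite Im_inv.
by apply: measurable_funN; exact: measurable_funM.
Qed.

Lemma cmeas_sum (I : Type) (r : seq I) (P : pred I) (F : I -> T -> R[i]) :
  (forall i, cmeas (F i)) -> cmeas (fun w => \sum_(i <- r | P i) F i w).
Proof.
move=> mF; elim: r => [|i r IH].
  by apply: (eq_cmeas (f := fun=> 0)); [move=> w; rewrite big_nil|exact: cmeas_cst].
have [Pi|Pi] := boolP (P i).
  apply: (eq_cmeas (f := fun w => F i w + \sum_(i <- r | P i) F i w)).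
    by move=> w; rewrite big_cons Pi.
  exact: cmeasD.
by apply: eq_cmeas IH => w; rewrite big_cons (negbTE Pi).
Qed.

Lemma cmeas_prod (I : Type) (r : seq I) (F : I -> T -> R[i]) :
  (forall i, cmeas (F i)) -> cmeas (fun w => \prod_(i <- r) F i w).
Proof.
move=> mF; elim: r => [|i r IH].
  by apply: (eq_cmeas (f := fun=> 1)); [move=> w; rewrite big_nil|exact: cmeas_cst].
apply: (eq_cmeas (f := fun w => F i w * \prod_(i <- r) F i w)).
  by move=> w; rewrite big_cons.
exact: cmeasM.
Qed.

Definition cmeas_mx m n (A : T -> 'M[R[i]]_(m, n)) : Prop :=
  forall i j, cmeas (fun w => A w i j).

Lemma cmeas_mulmx m n p (A : T -> 'M[R[i]]_(m, n)) (B : T -> 'M[R[i]]_(n, p)) :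
  cmeas_mx A -> cmeas_mx B -> cmeas_mx (fun w => A w *m B w).
Proof.
move=> mA mB i j.
apply: (eq_cmeas (f := fun w => \sum_k A w i k * B w k j)).
  by move=> w; rewrite mxE.
by apply: cmeas_sum => k; exact: cmeasM.
Qed.

Lemma cmeas_det n (A : T -> 'M[R[i]]_n) : cmeas_mx A -> cmeas (fun w => \det (A w)).
Proof.
move=> mA; apply: cmeas_sum => s; apply: cmeasM; first exact: cmeas_cst.
by apply: cmeas_prod => i; exact: mA.
Qed.

Lemma cmeas_invmx n (A : T -> 'M[R[i]]_n) : (forall w, A w \in unitmx) ->
  cmeas_mx A -> cmeas_mx (fun w => invmx (A w)).
Proof.
move=> uA mA i j.
apply: (eq_cmeas (f := fun w => (\det (A w))^-1 * \adj (A w) i j)).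
  by move=> w; rewrite /invmx uA [RHS]mxE.
apply: cmeasM; first by apply: cmeasV; exact: cmeas_det.
apply: (eq_cmeas (f := fun w => (-1) ^+ (j + i) * \det (row' j (col' i (A w))))).
  by move=> w; rewrite mxE.
apply: cmeasM; first exact: cmeas_cst.
apply: cmeas_det => k l.
by apply: (eq_cmeas (f := fun w => A w (lift j k) (lift i l))) => // w; rewrite !mxE.
Qed.

Lemma cmeas_resolvent n (C : T -> 'M[R[i]]_n) z : 0 < complex.Im z ->
  (forall w, C w \is hermsymmx) -> cmeas_mx C ->
  cmeas_mx (fun w => resolvent (C w) z).
Proof.
move=> hz hC mC; apply: cmeas_invmx => [w|i j]; first exact: resolvent_unit.
apply: (eq_cmeas (f := fun w => C w i j - z%:M i j)).
  by move=> w; rewrite !mxE.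
by apply: cmeasB => //; exact: cmeas_cst.
Qed.

Lemma cmeas_dot n (u v : T -> 'cV[R[i]]_n) : cmeas_mx u -> cmeas_mx v ->
  cmeas (fun w => dot (u w) (v w)).
Proof.
move=> mu mv; apply: cmeas_sum => i; apply: cmeasM; last exact: mv.
exact/cmeas_conj/mu.
Qed.

Lemma measurable_normsq n (u : T -> 'cV[R[i]]_n) : cmeas_mx u ->
  measurable_fun setT (fun w => normsq (u w)).
Proof.
move=> mu; have [+ _] := cmeas_dot mu mu.
by under eq_fun do rewrite -normsq_Re.
Qed.

Lemma cmeas_schur n (a : T -> R) (b : T -> 'cV[R[i]]_n) C z :
  0 < complex.Im z -> measurable_fun setT a -> cmeas_mx b ->
  (forall w, C w \is hermsymmx) -> cmeas_mx C ->
  cmeas (fun w => schur_function (a w) (b w) (C w) z).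
Proof.
move=> hz ma mb hC mC; apply: cmeasD.
  by apply: cmeasB; [exact: cmeas_real|exact: cmeas_cst].
by apply: cmeas_dot => //; apply: cmeas_mulmx => //; exact: cmeas_resolvent.
Qed.

Lemma measurable_ler_set (f g : T -> R) : measurable_fun setT f ->
  measurable_fun setT g -> measurable [set w | f w <= g w].
Proof.
move=> mf mg; have := measurable_fun_ler mf mg measurableT (_ : measurable [set true]).
by rewrite setTI; apply.
Qed.

Lemma measurable_ltr_set (f g : T -> R) : measurable_fun setT f ->
  measurable_fun setT g -> measurable [set w | f w < g w].
Proof.
move=> mf mg; have := measurable_fun_ltr mf mg measurableT (_ : measurable [set true]).
by rewrite setTI; apply.
Qed.

Lemma measurable_fun_le_cst (f : T -> R) :
  (forall c, measurable [set w | f w <= c]) -> measurable_fun setT f.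
Proof.
move=> mf; apply: (measurability _ (RGenOInfty.measurableE R)).
move=> _ [_ [c ->] <-]; rewrite setTI.
rewrite (_ : _ @^-1` _ = ~` [set w | f w <= c]); first exact: measurableC.
apply/seteqP; split => w /=; rewrite in_itv /= andbT ltNge => /negP //.
Qed.

End ComplexMeasurability.

Section MeasurableEigenvalue.
Context {R : realType} d (T : measurableType d) (n : nat).
Variables (a : T -> R) (b : T -> 'cV[R[i]]_n) (C : T -> 'M[R[i]]_n).
Variable beta : T -> R[i].
Hypotheses (ma : measurable_fun setT a) (mb : cmeas_mx b) (mC : cmeas_mx C).
Hypothesis hC : forall w, C w \is hermsymmx.
Hypothesis hbeta : forall w, exists u, nonpositive_solution (a w) (b w) (C w) u (beta w).

Let eta (k : nat) : R := k.+1%:R^-1.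

(** The event is the intersection over [k] of the events that some rational
    vector solves the equations up to [eta k] with a value of coordinate at most
    [c + eta k].  One inclusion is the density of rational vectors, the other
    the stability of the value. *)
Lemma measurable_coordinate_le (g : R[i] -> R) :
  (forall f : T -> R[i], cmeas f -> measurable_fun setT (g \o f)) ->
  (forall z w, `|g z - g w| <= normc (z - w)) ->
  forall c, measurable [set w | g (beta w) <= c].
Proof.
move=> mg lip c.
pose val (q : 'cV[(rat * rat)%type]_n) w := solution_value (a w) (b w) (rational_col q).
pose A k q := [set w | approx_solution (a w) (b w) (C w) (eta k) (rational_col q)]
  `&` [set w | g (val q w) <= c + eta k].
have mcst q : cmeas_mx (fun=> rational_col q : 'cV[R[i]]_n) (T := T).
  by move=> i j; exact: cmeas_cst.
have mval q : cmeas (val q).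
  apply: cmeasB; first exact: cmeas_real.
  by apply: cmeas_dot => //; exact: mcst.
have mA k q : measurable (A k q).
  apply: measurableI; last first.
    by apply: measurable_ler_set => //; exact: (mg (val q)).
  have -> : [set w | approx_solution (a w) (b w) (C w) (eta k) (rational_col q)] =
    [set w | normsq (solution_residue (a w) (b w) (C w) (rational_col q))
               <= eta k ^+ 4] `&`
    ([set w | normsq (rational_col q : 'cV[R[i]]_n) <= 1 + eta k] `&`
     [set w | - eta k <= complex.Im (val q w)]).
    by apply/seteqP; split => w [] // h1 [].
  apply: measurableI; last apply: measurableI.
  - apply: measurable_ler_set => //; apply: measurable_normsq => i j.
    apply: (eq_cmeas (f := fun w => b w i j + (C w *m rational_col q) i j -
       val q w * (rational_col q : 'cV[R[i]]_n) i j)); first by move=> w; rewrite !mxE.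
    apply: cmeasB; last by apply: cmeasM => //; exact: cmeas_cst.
    by apply: cmeasD => //; apply: cmeas_mulmx => //; exact: mcst.
  - exact: measurable_ler_set.
  - by apply: measurable_ler_set => //; have [] := mval q.
suff -> : [set w | g (beta w) <= c] = \bigcap_k \bigcup_q A k q.
  apply: bigcapT_measurable => k; apply: countable_bigcupT_measurable => //.
apply/seteqP; split => w /=.
  move=> gc k _.
  have [u hu] := hbeta w.
  have e0 : 0 < eta k by rewrite invr_gt0.
  have [delta d0 near] := approx_solution_near hu e0.
  have [q hq] := rational_col_dense u d0.
  have [h1 h2] := near _ hq; exists q => //; split => //=.
  have := le_trans (ler_norm _) (le_trans (lip (val q w) (beta w)) _).
  rewrite normc_subC => /(_ _ h2); lra.
move=> h; have [u hu] := hbeta w.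
have b0 := normsq_ge0 (b w).
apply/ler_addgt0Pr => e e0.
set r := Order.min (Order.min 1 (e / 2)) (e ^+ 2 / 4 / (10 + 3 * normsq (b w))).
have D0 : 0 < 10 + 3 * normsq (b w) by rewrite ltr_pwDl// mulr_ge0.
have r0 : 0 < r by rewrite !lt_min ltr01 !divr_gt0// exprn_gt0.
have [k] := ltr_add_invr r0; rewrite add0r => /ltW.
rewrite -/(eta k) !le_min -andbA => /and3P[eta1 eta2].
rewrite ler_pdivlMr// => eta3.
have ek0 : 0 < eta k by rewrite invr_gt0.
have [q _ [/= h1 h2]] := h k I.
have h3 := approx_solution_value (hC w) hu ek0 h1.
have h4 : normc (beta w - val q w) <= e / 2.
  rewrite -(@ler_pXn2r _ 2) ?nnegrE ?normc_ge0 ?divr_ge0 ?(ltW e0)//.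
  apply: le_trans h3 _; have : eta k ^+ 2 <= eta k by rewrite expr2 ler_piMr// ltW.
  by move: eta3; rewrite mulrDr expr_div_n; lra.
have := le_trans (ler_norm _) (le_trans (lip (beta w) (val q w)) h4).
by move: h2 eta2; lra.
Qed.

Lemma cmeas_nonpositive_eigenvalue : cmeas beta.
Proof.
split; apply: measurable_fun_le_cst.
  apply: measurable_coordinate_le => [f []//|z w].
  by rewrite -ReN -ReD Re_le_normc.
apply: measurable_coordinate_le => [f []//|z w].
by rewrite -ImN -ImD Im_le_normc.
Qed.

End MeasurableEigenvalue.

(** * Independence *)

Section BoundedIntegrals.
Context {R : realType} d (T : measurableType d) (P : probability T R).

Lemma bounded_integrable (f : T -> R) M : measurable_fun setT f ->
  (forall w, `|f w| <= M) -> P.-integrable setT (EFin \o f).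
Proof.
move=> mf bf; apply: measurable_bounded_integrable => //.
  exact: le_lt_trans (probability_le1 P measurableT) (ltry _).
exists M; split; first exact: num_real.
by move=> x Mx w _; exact: le_trans (bf w) (ltW Mx).
Qed.

End BoundedIntegrals.

Section IndependentIntegrals.
Context {R : realType} d (T : measurableType d) (P : probability T R).
Variables F G : set (set T).
Hypotheses (Fm : F `<=` measurable) (Gm : G `<=` measurable).
Hypothesis FG : independent_systems P <<s F >> <<s G >>.

Let TF := g_sigma_algebraType F.
Let TG := g_sigma_algebraType G.

Lemma measurable_fun_sub (H : set (set T)) d' (T' : measurableType d') (f : T -> T') :
  H `<=` measurable -> measurable_fun (setT : set (g_sigma_algebraType H)) f ->
  measurable_fun (setT : set T) f.
Proof.
move=> Hm mf _ A mA; have := mf measurableT A mA.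
by apply: smallest_sub => //; exact: sigma_algebra_measurable.
Qed.

(** The diagonal map from [T] to the product of [T] with its two sub-sigma-algebras
    pushes [P] to a product measure; Fubini concludes. *)
Lemma independent_Rintegral (f g : T -> R) (M : R) :
  measurable_fun (setT : set TF) f -> measurable_fun (setT : set TG) g ->
  (forall w, `|f w| <= M) -> (forall w, `|g w| <= M) ->
  \int[P]_w (f w * g w) = (\int[P]_w f w) * (\int[P]_w g w).
Proof.
move=> mf mg bf bg.
have mF : measurable_fun (setT : set T) (id : T -> TF).
  by apply: measurable_fun_sub Fm _; exact: measurable_id.
have mG : measurable_fun (setT : set T) (id : T -> TG).
  by apply: measurable_fun_sub Gm _; exact: measurable_id.
pose XF : {mfun T >-> TF} := HB.pack (id : T -> TF) (isMeasurableFun.Build _ _ _ _ _ mF).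
pose XG : {mfun T >-> TG} := HB.pack (id : T -> TG) (isMeasurableFun.Build _ _ _ _ _ mG).
have mZ := measurable_fun_pair mF mG.
pose Z : {mfun T >-> (TF * TG)%type} := HB.pack (fun w : T => (w : TF, w : TG))
  (isMeasurableFun.Build _ _ _ _ _ mZ).
have prodE := @product_measure_unique _ _ _ _ _ (distribution P XF)
  (distribution P XG) (distribution P Z) (fun A B mA mB => FG mA mB).
have mf' : measurable_fun (setT : set T) f by exact: measurable_fun_sub Fm mf.
have mg' : measurable_fun (setT : set T) g by exact: measurable_fun_sub Gm mg.
have mh : measurable_fun (setT : set (TF * TG)) (fun z => (f z.1 * g z.2)%:E).
  apply/measurable_EFinP; apply: measurable_funM.
    by apply: measurableT_comp => //; exact: measurable_fst.
  by apply: measurableT_comp => //; exact: measurable_snd.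
have M0 : 0 <= M by exact: le_trans (bf point).
have bh (z : TF * TG) : `|f z.1 * g z.2| <= M * M by rewrite normrM ler_pM.
have ih : (distribution P XF \x distribution P XG)%E.-integrable setT
    (fun z : TF * TG => (f z.1 * g z.2)%:E).
  apply: (measurable_bounded_integrable measurableT).
  - apply: (@le_lt_trans _ _ (distribution P Z setT)).
      by rewrite -[leRHS]prodE.
    exact: le_lt_trans (probability_le1 _ measurableT) (ltry _).
  - exact/measurable_EFinP.
  - exists (M * M); split; first exact: num_real.
    by move=> x Mx z _; exact: le_trans (bh z) (ltW Mx).
have If : P.-integrable setT (EFin \o f) by exact: bounded_integrable mf' bf.
have Ig : P.-integrable setT (EFin \o g) by exact: bounded_integrable mg' bg.
have Ifin : (\int[P]_w (f w)%:E)%E \is a fin_num by exact: integrable_fin_num.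
have Igin : (\int[P]_w (g w)%:E)%E \is a fin_num by exact: integrable_fin_num.
rewrite /Rintegral -fineM//; congr fine.
transitivity (\int[distribution P Z]_z (f z.1 * g z.2)%:E)%E.
  rewrite integral_distribution//=.
  apply: (@bounded_integrable _ _ _ _ _ (M * M)); first exact: measurable_funM.
  by move=> w; exact: (bh (w, w)).
transitivity (\int[(distribution P XF \x distribution P XG)%E]_z (f z.1 * g z.2)%:E)%E.
  by apply/esym/eq_measure_integral => A mA _; exact: prodE.
rewrite -integral12_prod_meas1// /fubini_F /=.
transitivity (\int[distribution P XF]_x ((f x)%:E * \int[P]_w (g w)%:E))%E.
  apply: eq_integral => x _.
  under eq_integral do rewrite EFinM.
  have IgG : (distribution P XG).-integrable setT (EFin \o g).
    by apply: (@bounded_integrable _ _ TG (distribution P XG)) mg bg.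
  rewrite integralZl//; congr (_ * _)%E.
  by rewrite integral_distribution//; exact/measurable_EFinP.
rewrite -(fineK Igin).
rewrite [LHS](_ : _ = \int[distribution P XF]_x ((fine (\int[P]_w (g w)%:E))%:E * (f x)%:E))%E; last first.
  by apply: eq_integral => x _; rewrite muleC.
have IfF : (distribution P XF).-integrable setT (EFin \o f).
  by apply: (@bounded_integrable _ _ TF (distribution P XF)) mf bf.
rewrite integralZl// muleC; congr (_ * _)%E.
by rewrite integral_distribution//; exact/measurable_EFinP.
Qed.

Lemma independent_complex_integral (f g : T -> R[i]) (M : R) :
  cmeas (f : TF -> R[i]) -> cmeas (g : TG -> R[i]) ->
  (forall w, normc (f w) <= M) -> (forall w, normc (g w) <= M) ->
  complex_integral P (fun w => f w * g w) =
  complex_integral P f * complex_integral P g.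
Proof.
move=> [mf1 mf2] [mg1 mg2] bf bg.
have bf1 w : `|complex.Re (f w)| <= M by rewrite (le_trans (Re_le_normc _)).
have bf2 w : `|complex.Im (f w)| <= M by rewrite (le_trans (Im_le_normc _)).
have bg1 w : `|complex.Re (g w)| <= M by rewrite (le_trans (Re_le_normc _)).
have bg2 w : `|complex.Im (g w)| <= M by rewrite (le_trans (Im_le_normc _)).
have intM (u v : T -> R) : measurable_fun (setT : set TF) u ->
    measurable_fun (setT : set TG) v -> (forall w, `|u w| <= M) ->
    (forall w, `|v w| <= M) -> P.-integrable setT (EFin \o (fun w => u w * v w)).
  move=> mu mv bu bv; apply: (@bounded_integrable _ _ _ _ _ (M * M)).
    apply: measurable_funM; first exact: measurable_fun_sub Fm mu.
    exact: measurable_fun_sub Gm mv.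
  by move=> w; rewrite normrM ler_pM.
rewrite /complex_integral; apply/eqP; rewrite eq_complex; apply/andP; split; apply/eqP => /=.
  under eq_Rintegral do rewrite ReM.
  by rewrite RintegralB ?(independent_Rintegral (M := M))//; exact: intM.
under eq_Rintegral do rewrite ImM.
by rewrite RintegralD ?(independent_Rintegral (M := M))//; exact: intM.
Qed.

End IndependentIntegrals.

Section IndependentOfTheOthers.
Context {R : realType} d (T : measurableType d) (P : probability T R).
Variable x : nat -> T -> R[i].
Hypotheses (mx : forall j, complex_rv (x j)) (indx : mutually_independent P x).

Definition generated_one (m : nat) : set (set T) :=
  preimage_set_system setT (reim \o x m) measurable.

Definition generated_others (m : nat) : set (set T) :=
  \bigcup_(j in [set j | j != m]) preimage_set_system setT (reim \o x j) measurable.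

Lemma generated_one_measurable m : generated_one m `<=` measurable.
Proof. by move=> _ [A mA <-]; exact: mx. Qed.

Lemma generated_others_measurable m : generated_others m `<=` measurable.
Proof. by move=> _ [j _ [A mA <-]]; exact: mx. Qed.

Let cylinder (J : {fset nat}) (A : nat -> set (R * R)) : set T :=
  \bigcap_(j in [set` J]) ((reim \o x j) @^-1` A j).

Let cylinders m : set (set T) :=
  [set B | exists J A, [/\ m \notin J, forall j, measurable (A j) & B = cylinder J A]].

Let mpre j A : measurable A -> measurable ((reim \o x j) @^-1` A).
Proof. by move=> mA; rewrite -[X in measurable X]setTI; exact: mx. Qed.

Let cylinders_measurable m : cylinders m `<=` measurable.
Proof.
move=> _ [J [A [_ mA ->]]]; apply: fin_bigcap_measurable => // j _.
exact: mpre.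
Qed.

Let cylinders_setI m : setI_closed (cylinders m).
Proof.
move=> _ _ [J [A [mJ mA ->]]] [K [B [mK mB ->]]].
exists (J `|` K)%fset, (fun j => (if j \in J then A j else setT) `&`
  (if j \in K then B j else setT)); split.
- by rewrite in_fsetU negb_or mJ.
- by move=> j; apply: measurableI; case: ifP.
- rewrite /cylinder; apply/seteqP; split=> w.
    move=> [h1 h2] j /=; rewrite in_fsetU => hj; split; case: ifP => // h.
      exact: h1.
    exact: h2.
  move=> h; split => j /= hj.
    have /= := h j; rewrite in_fsetU hj /= => /(_ isT) [] //.
  have /= := h j; rewrite in_fsetU hj orbT /= => /(_ isT) [] //.
Qed.

Let cylinders_indep m A B : measurable A -> cylinders m B ->
  P (B `&` (reim \o x m) @^-1` A) = (P ((reim \o x m) @^-1` A) * P B)%E.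
Proof.
move=> mA [J [D [mJ mD ->]]].
pose E j := if j == m then A else D j.
have mE j : measurable (E j) by rewrite /E; case: ifP.
have eqD : cylinder J D = cylinder J E.
  apply: eq_bigcapr => j /= jJ; rewrite /E; case: eqP => // jm.
  by move: mJ; rewrite -jm jJ.
have -> : cylinder J D `&` (reim \o x m) @^-1` A = cylinder (m |` J)%fset E.
  rewrite eqD; apply/seteqP; split => w.
    move=> [h1 h2] j /=; rewrite in_fset1U => /orP[/eqP ->|]; last exact: h1.
    by rewrite /E eqxx.
  move=> h; split.
    by move=> j /= jJ; apply: h; rewrite /= in_fset1U jJ orbT.
  by have := h m; rewrite /= in_fset1U eqxx /= /E eqxx; exact.
rewrite indx// eqD indx// big_fsetU1//=; congr (_ * _)%E.
by rewrite /E eqxx.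
Qed.

(** Mutual independence speaks of finite subfamilies only.  The cylinders over
    indices other than [m] form a pi-system that generates the second
    sigma-algebra, and on it the finite measures [P (_ `&` A)] and [P A * P _]
    agree. *)
Lemma independent_of_others m :
  independent_systems P <<s generated_one m >> <<s generated_others m >>.
Proof.
move=> A B FA GB.
have [D mD <-] : generated_one m A.
  move: FA; rewrite sigma_algebra_id//.
  apply: sigma_algebra_preimage; exact: sigma_algebra_measurable.
rewrite setTI.
have mA := mpre m mD.
have PA0 : 0 <= fine (P ((reim \o x m) @^-1` D)) by rewrite fine_ge0.
have := @g_sigma_algebra_measure_unique _ R T (cylinders m)
  (@cylinders_measurable m) (fun=> setT) _ _ (mrestr P mA)
  (mscale (NngNum PA0) P) (@cylinders_setI m) _ _ B.
have cT : cylinders m setT.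
  exists fset0, (fun=> setT); split => //.
  by rewrite /cylinder; apply/seteqP; split => w.
have bT : \bigcup_(_ : nat) [set: T] = [set: T].
  by apply: bigcup_const; exists 0%N.
move=> /(_ (fun=> cT) bT) h.
have : mrestr P mA B = mscale (NngNum PA0) P B.
  apply: h => //.
  - move=> E cE; rewrite /= /mrestr /mscale /= cylinders_indep// fineK//.
    exact: fin_num_measure.
  - by move=> _; rewrite /= /mrestr setTI -ge0_fin_numE// fin_num_measure.
  - suff : <<s generated_others m >> `<=` <<s cylinders m >> by exact.
    apply: sub_smallest2r; first exact: smallest_sigma_algebra.
    move=> _ [j jm [E mE <-]]; exists [fset j]%fset, (fun=> E); split => //.
      by rewrite inE eq_sym.
    rewrite setTI /cylinder; apply/seteqP; split => w /=.
      by move=> h1 k /=; rewrite inE => /eqP ->.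
    by apply; rewrite /= inE.
rewrite /= /mrestr /mscale /= setIC => ->.
by rewrite fineK// fin_num_measure.
Qed.

End IndependentOfTheOthers.

(** * Bounded complex random variables *)

Section BoundedComplexVariables.
Context {R : realType} d (T : measurableType d).
Implicit Types f g : T -> R[i].

(** On bounded variables the complex integral is linear and commutes with
    conjugation without any integrability condition to carry along. *)
Definition cbdd f : Prop := cmeas f /\ exists M, forall w, normc (f w) <= M.

Lemma cbdd_cst z : cbdd (fun=> z).
Proof. by split; [exact: cmeas_cst|exists (normc z)]. Qed.

Lemma cbddD f g : cbdd f -> cbdd g -> cbdd (fun w => f w + g w).
Proof.
move=> [mf [M hM]] [mg [N hN]]; split; first exact: cmeasD.
by exists (M + N) => w; rewrite (le_trans (normc_add _ _))// lerD.
Qed.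

Lemma cbddN f : cbdd f -> cbdd (fun w => - f w).
Proof.
move=> [mf [M hM]]; split; first exact: cmeasN.
by exists M => w; rewrite normc_opp.
Qed.

Lemma cbddM f g : cbdd f -> cbdd g -> cbdd (fun w => f w * g w).
Proof.
move=> [mf [M hM]] [mg [N hN]]; split; first exact: cmeasM.
by exists (M * N) => w; rewrite normc_mul ler_pM// normc_ge0.
Qed.

Lemma cbdd_conj f : cbdd f -> cbdd (fun w => (f w)^*).
Proof.
move=> [mf [M hM]]; split; first exact: cmeas_conj.
by exists M => w; rewrite normc_conj.
Qed.

Lemma cbdd_normc_sqr f : cbdd f -> cbdd (fun w => (normc (f w) ^+ 2)%:C).
Proof.
move=> bf; have -> : (fun w => (normc (f w) ^+ 2)%:C) = (fun w => (f w)^* * f w).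
  by apply/funext => w; rewrite conj_mul.
by apply: cbddM => //; exact: cbdd_conj.
Qed.

Lemma cbdd_sum (I : Type) (r : seq I) (P : pred I) (F : I -> T -> R[i]) :
  (forall i, cbdd (F i)) -> cbdd (fun w => \sum_(i <- r | P i) F i w).
Proof.
move=> bF; split; first by apply: cmeas_sum => i; case: (bF i).
have /choice[M hM] i : exists M, forall w, normc (F i w) <= M by case: (bF i).
exists (\sum_(i <- r | P i) M i) => w.
elim/big_ind2: _ => [|z x z' y h h'|i _]; first by rewrite normc_0.
  by rewrite (le_trans (normc_add _ _))// lerD.
exact: hM.
Qed.

Variable P : probability T R.
Local Notation E := (complex_integral P).

Lemma cbdd_integrable f : cbdd f ->
  P.-integrable setT (EFin \o (fun w => complex.Re (f w))) /\
  P.-integrable setT (EFin \o (fun w => complex.Im (f w))).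
Proof.
move=> [[mf1 mf2] [M hM]]; split; apply: (@bounded_integrable _ _ _ P _ M) => // w.
  exact: le_trans (Re_le_normc _) _.
exact: le_trans (Im_le_normc _) _.
Qed.

Lemma complex_integralE f :
  E f = (\int[P]_w complex.Re (f w)) +i* (\int[P]_w complex.Im (f w)).
Proof. by []. Qed.

Lemma complex_integral_cst z : E (fun=> z) = z.
Proof.
rewrite complex_integralE !Rintegral_cst//= [X in fine X](_ : _ = 1%E) ?mulr1.
  by case: z.
exact: probability_setT.
Qed.

Lemma complex_integralD f g : cbdd f -> cbdd g ->
  E (fun w => f w + g w) = E f + E g.
Proof.
move=> /cbdd_integrable[f1 f2] /cbdd_integrable[g1 g2]; rewrite !complex_integralE.
under eq_Rintegral do rewrite ReD.
rewrite RintegralD//; congr (_ +i* _).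
by under eq_Rintegral do rewrite ImD; rewrite RintegralD.
Qed.

Lemma complex_integralN f : cbdd f -> E (fun w => - f w) = - E f.
Proof.
move=> bf; apply/eqP; rewrite -addr_eq0 -complex_integralD//; last exact: cbddN.
apply/eqP; rewrite -(complex_integral_cst 0); congr E.
by apply/funext => w; rewrite addNr.
Qed.

Lemma complex_integral_conj f : cbdd f -> E (fun w => (f w)^*) = (E f)^*.
Proof.
move=> bf; have [_ iN] := cbdd_integrable bf; rewrite !complex_integralE /=.
under eq_Rintegral do rewrite Re_conj.
congr (_ +i* _); have := complex_integralN bf.
rewrite !complex_integralE => /(congr1 (fun z => complex.Im z)) /= <-.
by apply: eq_Rintegral => w _; rewrite Im_conj ImN.
Qed.

Lemma complex_integral_sum (I : Type) (r : seq I) (Q : pred I) (F : I -> T -> R[i]) :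
  (forall i, cbdd (F i)) ->
  E (fun w => \sum_(i <- r | Q i) F i w) = \sum_(i <- r | Q i) E (F i).
Proof.
move=> bF; elim: r => [|i r IH].
  rewrite big_nil -[RHS](complex_integral_cst 0); congr E.
  by apply/funext => w; rewrite big_nil.
rewrite big_cons -IH; have [Qi|Qi] := boolP (Q i).
  rewrite -complex_integralD//; last exact: cbdd_sum.
  by congr E; apply/funext => w; rewrite big_cons Qi.
by congr E; apply/funext => w; rewrite big_cons (negbTE Qi).
Qed.

Lemma le_Re_complex_integral f (c : R) : cbdd f ->
  (forall w, complex.Re (f w) <= c) -> complex.Re (E f) <= c.
Proof.
move=> /cbdd_integrable[f1 _] fc.
rewrite [leRHS](_ : c = complex.Re (E (fun=> c%:C))); last first.
  by rewrite complex_integral_cst.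
apply: le_Rintegral => //.
apply: (@bounded_integrable _ _ _ P _ `|c|) => //; exact: measurable_cst.
Qed.

Lemma markov_ineq (f : T -> R) (eps : R) : 0 < eps -> measurable_fun setT f ->
  (forall w, 0 <= f w) ->
  (eps%:E * P [set w | (eps < f w)%R] <= \int[P]_w (f w)%:E)%E.
Proof.
move=> e0 mf f0.
have mA : measurable [set w | eps < f w].
  by apply: measurable_ltr_set => //; exact: measurable_cst.
rewrite -integral_cst//.
apply: (@le_trans _ _ (\int[P]_(w in [set w | (eps < f w)%R]) (f w)%:E)%E).
  apply: ge0_le_integral => //.
  - by move=> w _; rewrite lee_fin ltW.
  - by apply/measurable_EFinP; exact: measurable_funTS.
  - by move=> w /= h; rewrite lee_fin ltW.
apply: ge0_subset_integral => //; first exact/measurable_EFinP.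
by move=> w _; rewrite lee_fin.
Qed.

End BoundedComplexVariables.

Lemma cbdd_sub {R : realType} d (T : measurableType d) (H : set (set T))
    (f : T -> R[i]) : H `<=` measurable ->
  cbdd (f : g_sigma_algebraType H -> R[i]) -> cbdd f.
Proof.
by move=> Hm [[m1 m2] hM]; split => //; split; exact: measurable_fun_sub Hm _.
Qed.

Lemma independent_complex_integral_cbdd {R : realType} d (T : measurableType d)
    (P : probability T R) (F G : set (set T)) (f g : T -> R[i]) :
  F `<=` measurable -> G `<=` measurable ->
  independent_systems P <<s F >> <<s G >> ->
  cbdd (f : g_sigma_algebraType F -> R[i]) ->
  cbdd (g : g_sigma_algebraType G -> R[i]) ->
  complex_integral P (fun w => f w * g w) =
  complex_integral P f * complex_integral P g.
Proof.
move=> Fm Gm FG [mf [M hM]] [mg [N hN]].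
apply: (independent_complex_integral Fm Gm FG (M := Order.max M N)) => // w.
  by rewrite (le_trans (hM w))// le_max lexx.
by rewrite (le_trans (hN w))// le_max lexx orbT.
Qed.

(** * Variance of a centered quadratic form *)

Section QuadraticForm.
Context {R : realType} d (T : measurableType d) (P : probability T R).
Variable x : nat -> T -> R[i].
Hypotheses (mx : forall j, complex_rv (x j)) (indx : mutually_independent P x).
Variables (h : R[i] -> R[i]) (K sigma2 : R).
Hypothesis mh : forall d' (T' : measurableType d') (f : T' -> R[i]),
  cmeas f -> cmeas (fun w => h (f w)).
Hypothesis bh : forall z, normc (h z) <= K.
Local Notation E := (complex_integral P).
Hypothesis Eh : forall j, E (fun w => h (x j w)) = 0.
Hypothesis Eh2 : forall j, E (fun w => (normc (h (x j w)) ^+ 2)%:C) = sigma2%:C.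

Let y j w := h (x j w).

(** The coefficient of entry [(i, j)] of the matrix in the form
    [y^* A y - sigma2 tr A], where [y_j = h (x_j)]. *)
Definition centered_product (i j : nat) (w : T) : R[i] :=
  (h (x i w))^* * h (x j w) - (if i == j then sigma2%:C else 0).
Local Notation Y := centered_product.

Let L := K ^+ 2 + `|sigma2|.

Lemma normc_centered_product i j w : normc (Y i j w) <= L.
Proof.
rewrite (le_trans (normc_sub _ _))// lerD//.
  by rewrite normc_mul normc_conj expr2 ler_pM// normc_ge0.
by case: ifP => _; [rewrite normc_real|rewrite normc_0].
Qed.

Lemma cbdd_generated (H : set (set T)) j :
  generated_one x j `<=` H -> cbdd (y j : g_sigma_algebraType H -> R[i]).
Proof.
move=> jH; split; last by exists K => w; exact: bh.
apply: mh; apply/complex_rvP => _ A mA.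
by apply: sub_sigma_algebra; apply: jH; exists A.
Qed.

Lemma generated_one_others j m : j != m -> generated_one x j `<=` generated_others x m.
Proof. by move=> jm A HA; exists j. Qed.

Let TO m := g_sigma_algebraType (generated_others x m).

Lemma cbdd_centered_product_others i j m : i != m -> j != m ->
  cbdd (Y i j : TO m -> R[i]).
Proof.
move=> im jm; apply: cbddD; last by apply: cbddN; exact: cbdd_cst.
by apply: cbddM; first apply: cbdd_conj; apply: cbdd_generated; exact: generated_one_others.
Qed.

Lemma cbdd_y j : cbdd (y j).
Proof.
apply: (@cbdd_sub _ _ _ (generated_one x j)); first exact: generated_one_measurable.
exact: cbdd_generated.
Qed.

Lemma cbdd_centered_product i j : cbdd (Y i j).
Proof.
apply: cbddD; last by apply: cbddN; exact: cbdd_cst.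
by apply: cbddM; first apply: cbdd_conj; exact: cbdd_y.
Qed.

(** A centered function of [x_m] is orthogonal to whatever does not involve [x_m]. *)
Lemma integral_alone m (g : T -> R[i]) (Z : T -> R[i]) :
  cbdd (g : g_sigma_algebraType (generated_one x m) -> R[i]) ->
  cbdd (Z : TO m -> R[i]) -> E g = 0 -> E (fun w => g w * Z w) = 0.
Proof.
move=> bg bZ Eg; rewrite (independent_complex_integral_cbdd _ _ _ bg bZ).
- by rewrite Eg mul0r.
- exact: generated_one_measurable.
- exact: generated_others_measurable.
- exact: independent_of_others.
Qed.

(** The variable [x_m] enters [Y i j] either through [|y_m|^2 - sigma2], when
    [i = j = m], or through a single factor [y_m] or its conjugate; both are
    centered. *)
Lemma integral_centered_product_alone i j m (Z : T -> R[i]) :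
  (m == i) || (m == j) -> cbdd (Z : TO m -> R[i]) ->
  E (fun w => Y i j w * Z w) = 0.
Proof.
move=> mij bZ; have [ij|ij] := eqVneq i j.
  have mi : m = i by move: mij; rewrite ij orbb => /eqP.
  subst j; subst m.
  have bg : cbdd (Y i i : g_sigma_algebraType (generated_one x i) -> R[i]).
    apply: cbddD; last by apply: cbddN; exact: cbdd_cst.
    by apply: cbddM; first apply: cbdd_conj; exact: cbdd_generated.
  apply: (integral_alone bg bZ).
  have -> : Y i i = (fun w => (normc (y i w) ^+ 2)%:C + (- sigma2%:C)).
    by apply/funext => w; rewrite /centered_product eqxx conj_mul.
  transitivity (E (fun w => (normc (y i w) ^+ 2)%:C) + E (fun=> - sigma2%:C)).
    apply: complex_integralD; last exact: cbdd_cst.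
    by apply: cbdd_normc_sqr; exact: cbdd_y.
  by rewrite Eh2 complex_integral_cst addrN.
have YE w : Y i j w = (y i w)^* * y j w.
  by rewrite /centered_product (negbTE ij) subr0.
have [mi|mi] := eqVneq m i.
  subst m.
  have -> : (fun w => Y i j w * Z w) = (fun w => (y i w)^* * (y j w * Z w)).
    by apply/funext => w; rewrite YE mulrA.
  apply: (@integral_alone i).
  - by apply: cbdd_conj; exact: cbdd_generated.
  - apply: cbddM => //; apply: cbdd_generated; apply: generated_one_others.
    by rewrite eq_sym.
  - by rewrite complex_integral_conj ?Eh ?conjc0//; exact: cbdd_y.
move: mij; rewrite (negbTE mi) /= => /eqP mj; subst m.
have -> : (fun w => Y i j w * Z w) = (fun w => y j w * ((y i w)^* * Z w)).
  by apply/funext => w; rewrite YE mulrCA mulrA.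
apply: (@integral_alone j).
- exact: cbdd_generated.
- apply: cbddM => //; apply: cbdd_conj; apply: cbdd_generated.
  exact: generated_one_others.
- exact: Eh.
Qed.

(** If [(k, l)] is neither [(i, j)] nor [(j, i)], then the sets [{i, j}] and [{k, l}]
    differ, and an index of their symmetric difference is alone. *)
Lemma covariance_centered_product i j k l :
  (k, l) != (i, j) -> (k, l) != (j, i) ->
  E (fun w => Y i j w * (Y k l w)^*) = 0.
Proof.
move=> h1 h2.
have alone m : (m == i) || (m == j) -> k != m -> l != m ->
    E (fun w => Y i j w * (Y k l w)^*) = 0.
  move=> mij km lm; apply: (integral_centered_product_alone mij).
  by apply: cbdd_conj; exact: cbdd_centered_product_others.
have alone' m : (m == k) || (m == l) -> i != m -> j != m ->
    E (fun w => Y i j w * (Y k l w)^*) = 0.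
  move=> mkl im jm.
  have -> : (fun w => Y i j w * (Y k l w)^*) = (fun w => (Y k l w * (Y i j w)^*)^*).
    by apply/funext => w; rewrite conjcM conjcK mulrC.
  rewrite complex_integral_conj; last first.
    by apply: cbddM; last apply: cbdd_conj; exact: cbdd_centered_product.
  rewrite (integral_centered_product_alone mkl) ?conjc0//.
  by apply: cbdd_conj; exact: cbdd_centered_product_others.
have [ik|ik] := eqVneq k i; last first.
  have [il|il] := eqVneq l i; last by apply: (alone i); rewrite ?eqxx.
  have [jk|jk] := eqVneq k j; last first.
    by apply: (alone' k); rewrite ?eqxx// eq_sym.
  by move: h2; rewrite il jk eqxx.
have [jl|jl] := eqVneq l j; first by move: h1; rewrite ik jl eqxx.
have [il|il] := eqVneq l i; last by apply: (alone' l); rewrite ?eqxx ?orbT// eq_sym.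
by apply: (alone j); rewrite ?eqxx ?orbT// ik -il.
Qed.

Variables (GC : set (set T)) (n : nat) (A : T -> 'M[R[i]]_n) (B : R).
Hypothesis GCm : GC `<=` measurable.
Hypothesis indC : independent_systems P (generated_by x) <<s GC >>.
Hypothesis bA : forall i j, cbdd ((fun w => A w i j) : g_sigma_algebraType GC -> R[i]).
Hypothesis sA : forall w, \sum_(p : 'I_n * 'I_n) normc (A w p.1 p.2) ^+ 2 <= B.

Definition centered_form (w : T) : R[i] :=
  \sum_(p : 'I_n * 'I_n) Y p.1 p.2 w * A w p.1 p.2.

Let t (p : 'I_n * 'I_n) w := Y p.1 p.2 w * A w p.1 p.2.

Let cbdd_A (p : 'I_n * 'I_n) : cbdd (fun w => A w p.1 p.2).
Proof. exact: cbdd_sub GCm (bA _ _). Qed.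

Lemma cbdd_form_term p : cbdd (t p).
Proof. by apply: cbddM; [exact: cbdd_centered_product|exact: cbdd_A]. Qed.

Let good (p q : 'I_n * 'I_n) := (q == p) || (q == (p.2, p.1)).

Lemma covariance_form_term p q : ~~ good p q -> E (fun w => t p w * (t q w)^*) = 0.
Proof.
case: p q => [i j] [k l]; rewrite /good negb_or /= => /andP[h1 h2].
have -> : (fun w => t (i, j) w * (t (k, l) w)^*) =
  (fun w => (Y i j w * (Y k l w)^*) * (A w i j * (A w k l)^*)).
  by apply/funext => w; rewrite /t conjcM /= mulrACA.
rewrite (@independent_complex_integral_cbdd _ _ _ _
  (\bigcup_i preimage_set_system setT (reim \o x i) measurable) GC)//.
- by rewrite covariance_centered_product ?mul0r.
- by move=> _ [m _ [D mD <-]]; exact: mx.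
- have gX m : cbdd (y m : g_sigma_algebraType
     (\bigcup_i preimage_set_system setT (reim \o x i) measurable) -> R[i]).
    by apply: cbdd_generated => D HD; exists m.
  have gY u v : cbdd (Y u v : g_sigma_algebraType
     (\bigcup_i preimage_set_system setT (reim \o x i) measurable) -> R[i]).
    apply: cbddD; last by apply: cbddN; exact: cbdd_cst.
    by apply: cbddM; first apply: cbdd_conj; exact: gX.
  by apply: cbddM; last apply: cbdd_conj; exact: gY.
- by apply: cbddM; last apply: cbdd_conj; exact: bA.
Qed.

(** Expand the square over pairs [(p, q)] of entries.  Independence from the
    matrix kills the pairs of uncorrelated coefficients; each [p] is left with at
    most two [q], for which [2 Re (t_p t_q^* ) <= |t_p|^2 + |t_q|^2]. *)
Lemma variance_centered_form :
  complex.Re (E (fun w => (normc (centered_form w) ^+ 2)%:C)) <= 2 * L ^+ 2 * B.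
Proof.
(* [s] collects the pairs that may be correlated, [s'] those that are not. *)
pose s w := \sum_p \sum_(q | good p q) t p w * (t q w)^*.
pose s' w := \sum_p \sum_(q | ~~ good p q) t p w * (t q w)^*.
have bt p q : cbdd (fun w => t p w * (t q w)^*).
  by apply: cbddM; last apply: cbdd_conj; exact: cbdd_form_term.
have bs : cbdd s by apply: cbdd_sum => p; exact: cbdd_sum.
have bs' : cbdd s' by apply: cbdd_sum => p; exact: cbdd_sum.
have -> : (fun w => (normc (centered_form w) ^+ 2)%:C) = (fun w => s w + s' w).
  apply/funext => w; rewrite -conj_mul mulrC /centered_form.
  rewrite conjc_sum mulr_suml -big_split; apply: eq_bigr => p _ /=.
  by rewrite mulr_sumr (bigID (good p)).
rewrite (complex_integralD P bs bs').
have -> : E s' = 0.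
  rewrite complex_integral_sum; last by move=> p; exact: cbdd_sum.
  apply: big1 => p _; rewrite complex_integral_sum//.
  by apply: big1 => q; exact: covariance_form_term.
rewrite addr0; apply: le_Re_complex_integral => // w.
pose a p := normc (t p w) ^+ 2.
have a0 p : 0 <= a p by rewrite sqr_ge0.
rewrite Re_sum.
apply: (@le_trans _ _ (\sum_p (a p + (a p + a (p.2, p.1)) / 2))).
  apply: ler_sum => p _; rewrite Re_sum.
  have le_term q : complex.Re (t p w * (t q w)^*) <= (a p + a q) / 2.
    rewrite (le_trans (ler_norm _))// (le_trans (Re_le_normc _))//.
    rewrite normc_mul normc_conj /a.
    have := sqr_ge0 (normc (t p w) - normc (t q w)); lra.
  apply: (@le_trans _ _ (\sum_(q | good p q) (a p + a q) / 2)).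
    by apply: ler_sum.
  rewrite big_mkcond /=.
  apply: (@le_trans _ _ (\sum_q ((if q == p then (a p + a q) / 2 else 0) +
     (if q == (p.2, p.1) then (a p + a q) / 2 else 0)))).
    apply: ler_sum => q _; rewrite /good.
    have h0 : 0 <= (a p + a q) / 2 by rewrite divr_ge0// addr_ge0.
    by case: eqP; case: eqP => //= _ _; lra.
  rewrite big_split -!big_mkcond !big_pred1_eq /= lerD2r.
  by have := a0 p; lra.
rewrite big_split /= -mulr_suml big_split /=.
have -> : \sum_(p : 'I_n * 'I_n) a (p.2, p.1) = \sum_p a p.
  have inj : injective (fun p : 'I_n * 'I_n => (p.2, p.1)).
    by move=> [i j] [k l] [-> ->].
  by rewrite [RHS](reindex_inj inj).
have : \sum_p a p <= L ^+ 2 * B.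
  apply: (@le_trans _ _ (\sum_(p : 'I_n * 'I_n) L ^+ 2 * normc (A w p.1 p.2) ^+ 2)).
    apply: ler_sum => p _; rewrite /a /t normc_mul exprMn ler_wpM2r ?sqr_ge0//.
    have L0 : 0 <= L by rewrite addr_ge0 ?sqr_ge0.
    by rewrite ler_pXn2r ?nnegrE ?normc_ge0// normc_centered_product.
  by rewrite -mulr_sumr ler_wpM2l ?sqr_ge0.
lra.
Qed.

End QuadraticForm.

(** * Truncation at the second moment *)

Section ErealNull.
Context {R : realType}.

Lemma cvg0_near_le (u : nat -> \bar R) : u @ \oo --> 0%E ->
  forall e : R, 0 < e -> \forall n \near \oo, (u n <= e%:E)%E.
Proof.
move=> /fine_cvgP[fu /cvgrPdist_le cu] e e0.
near=> n; have fn : u n \is a fin_num by near: n.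
rewrite -(fineK fn) lee_fin (le_trans (ler_norm _))// -normrN -[- _]add0r.
by near: n; exact: cu.
Unshelve. all: by end_near. Qed.

Lemma near_le_cvg0 (u : nat -> \bar R) : (forall n, (0 <= u n)%E) ->
  (forall e : R, 0 < e -> \forall n \near \oo, (u n <= e%:E)%E) ->
  u @ \oo --> 0%E.
Proof.
move=> u0 ue.
have fin (e : R) n : (u n <= e%:E)%E -> u n \is a fin_num.
  by move=> h; rewrite ge0_fin_numE// (le_lt_trans h)// ltry.
apply/fine_cvgP; split.
  by have := ue 1 ltr01; apply: filterS => n; exact: fin.
apply/cvgrPdist_le => e e0; have := ue e e0; apply: filterS => n h.
rewrite sub0r normrN ger0_norm ?fine_ge0// -lee_fin fineK//.
exact: fin h.
Qed.

End ErealNull.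

Section NonnegativeMean.
Context {R : realType} d (T : measurableType d) (P : probability T R).
Implicit Types f g : T -> R.

(** Expectations of nonnegative variables are kept extended-real, which makes
    them monotone and additive without integrability. *)
Definition mean_ge0 f : \bar R := (\int[P]_w (f w)%:E)%E.

Lemma le_mean_ge0 f g : measurable_fun setT f -> measurable_fun setT g ->
  (forall w, 0 <= f w) -> (forall w, f w <= g w) -> (mean_ge0 f <= mean_ge0 g)%E.
Proof.
move=> mf mg f0 fg; apply: ge0_le_integral => //.
- by move=> w _; rewrite lee_fin.
- exact/measurable_EFinP.
- exact/measurable_EFinP.
- by move=> w _; rewrite lee_fin.
Qed.

Lemma mean_ge0D f g : measurable_fun setT f -> measurable_fun setT g ->
  (forall w, 0 <= f w) -> (forall w, 0 <= g w) ->
  mean_ge0 (fun w => f w + g w) = (mean_ge0 f + mean_ge0 g)%E.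
Proof.
move=> mf mg f0 g0; rewrite /mean_ge0; under eq_integral do rewrite EFinD.
rewrite ge0_integralD//.
- by move=> w _; rewrite lee_fin.
- exact/measurable_EFinP.
- by move=> w _; rewrite lee_fin.
- exact/measurable_EFinP.
Qed.

Lemma mean_ge0Z k f : 0 <= k -> measurable_fun setT f -> (forall w, 0 <= f w) ->
  mean_ge0 (fun w => k * f w) = (k%:E * mean_ge0 f)%E.
Proof.
move=> k0 mf f0; rewrite /mean_ge0; under eq_integral do rewrite EFinM.
rewrite ge0_integralZl_EFin//; last by exact/measurable_EFinP.
by move=> w _; rewrite lee_fin.
Qed.

Lemma mean_ge0_cst k : mean_ge0 (fun=> k) = k%:E.
Proof.
rewrite /mean_ge0 integral_cst// [X in (_ * X)%E](_ : _ = 1%E) ?mule1//.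
exact: probability_setT.
Qed.

Lemma mean_ge0_sum (I : Type) (r : seq I) (F : I -> T -> R) :
  (forall i, measurable_fun setT (F i)) -> (forall i w, 0 <= F i w) ->
  mean_ge0 (fun w => \sum_(i <- r) F i w) = (\sum_(i <- r) mean_ge0 (F i))%E.
Proof.
move=> mF F0; rewrite /mean_ge0; under eq_integral do rewrite -sumEFin.
rewrite ge0_integral_sum//.
- by move=> i; exact/measurable_EFinP.
- by move=> i w _; rewrite lee_fin.
Qed.

Lemma mean_ge0_Rintegral f M : measurable_fun setT f -> (forall w, `|f w| <= M) ->
  mean_ge0 f = (\int[P]_w f w)%:E.
Proof.
move=> mf bf; rewrite /Rintegral fineK// integrable_fin_num//.
exact: bounded_integrable mf bf.
Qed.

End NonnegativeMean.

Section Truncation.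
Context {R : realType} d (T : measurableType d) (P : probability T R).
Variables (Z : T -> R[i]) (s : R).
Local Notation E := (complex_integral P).
Local Notation mean f := (mean_ge0 P f%R).
Hypotheses (mZ : cmeas Z) (EZ : E Z = 0).
Hypothesis VZ : mean (fun w => normc (Z w) ^+ 2) = (s ^+ 2)%:E.

Definition truncate (M : R) (z : R[i]) : R[i] := if normc z <= M then z else 0.

Lemma cmeas_truncate M d' (T' : measurableType d') (f : T' -> R[i]) :
  cmeas f -> cmeas (fun w => truncate M (f w)).
Proof.
move=> mf; have mb : measurable_fun setT (fun w => normc (f w) <= M).
  by apply: measurable_fun_ler; [exact: cmeas_normc|exact: measurable_cst].
have [m1 m2] := mf; split.
  rewrite (_ : (fun w => _) = (fun w => if normc (f w) <= M then complex.Re (f w) else 0)).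
    by apply: measurable_fun_ifT => //; exact: measurable_cst.
  by apply/funext => w; rewrite /truncate; case: ifP.
rewrite (_ : (fun w => _) = (fun w => if normc (f w) <= M then complex.Im (f w) else 0)).
  by apply: measurable_fun_ifT => //; exact: measurable_cst.
by apply/funext => w; rewrite /truncate; case: ifP.
Qed.

Lemma normc_truncate M z : 0 <= M -> normc (truncate M z) <= M.
Proof. by move=> M0; rewrite /truncate; case: ifP => // _; rewrite normc_0. Qed.

(** The square modulus of the part of [Z] removed by truncation at [M]. *)
Definition truncation_tail (M : R) (w : T) : R := normc (Z w - truncate M (Z w)) ^+ 2.

Lemma measurable_tail M : measurable_fun setT (truncation_tail M).
Proof. by apply: cmeas_normc_sqr; apply: cmeasB => //; exact: cmeas_truncate. Qed.

Lemma tail_le M w : truncation_tail M w <= normc (Z w) ^+ 2.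
Proof.
rewrite /truncation_tail /truncate; case: ifP => _; last by rewrite subr0.
by rewrite subrr normc_0 expr0n sqr_ge0.
Qed.

Lemma tail_ge0 M w : 0 <= truncation_tail M w. Proof. exact: sqr_ge0. Qed.

Let sqZ_integrable : P.-integrable setT (EFin \o (fun w => normc (Z w) ^+ 2)).
Proof.
apply/integrableP; split; first by apply/measurable_EFinP; exact: cmeas_normc_sqr.
under eq_integral do rewrite /= ger0_norm ?sqr_ge0//.
by rewrite -/(mean_ge0 P (fun w => normc (Z w) ^+ 2)) VZ ltry.
Qed.

(** Dominated convergence, with [|Z|^2] as the dominating function. *)
Lemma tail_vanishes (tau : R) : 0 < tau ->
  exists2 M, 1 <= M & (mean (truncation_tail M) <= tau%:E)%E.
Proof.
move=> tau0.
have [] := @dominated_convergence _ _ _ P setT measurableT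
  (fun n w => (truncation_tail n%:R w)%:E) (cst 0%E) (EFin \o (fun w => normc (Z w) ^+ 2)).
- by move=> n; apply/measurable_EFinP; exact: measurable_tail.
- exact: measurable_cst.
- apply: aeW => w _; apply: cvg_near_cst.
  near=> n; rewrite /truncation_tail /truncate ifT ?subrr ?normc_0 ?expr0n//.
  by near: n; exact: nbhs_infty_ger.
- exact: sqZ_integrable.
- apply: aeW => w n _; rewrite /= lee_fin ger0_norm ?tail_ge0//.
  exact: tail_le.
move=> _ _; rewrite integral0 => cv.
have [N _ hN] : \forall n \near \oo, (mean (truncation_tail n%:R) <= tau%:E)%E.
  exact: (cvg0_near_le cv tau0).
exists N.+1%:R; first by rewrite ler1n.
by apply: hN => /=.
Unshelve. all: by end_near. Qed.

(** As [Z] is centered, the mean of the truncation is minus that of the removed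
    part, whose modulus exceeds [M >= 1] where it is nonzero and is therefore
    at most its square. *)
Lemma normc_centering (M tau : R) : 1 <= M -> 0 <= tau -> (mean (truncation_tail M) <= tau%:E)%E ->
  normc (E (fun w => truncate M (Z w))) ^+ 2 <= 2 * tau ^+ 2.
Proof.
move=> M1 tau0 htau.
have [m1 m2] := mZ; have mt := cmeas_truncate M mZ.
have M0 : 0 <= M by exact: le_trans M1.
have bt : cbdd (fun w => truncate M (Z w)).
  by split => //; exists M => w; exact: normc_truncate.
have [it1 it2] := cbdd_integrable P bt.
have normZ_tail (w : T) : normc (Z w - truncate M (Z w)) <= truncation_tail M w.
  rewrite /truncation_tail /truncate; case: ifPn => [_|].
    by rewrite subrr normc_0 expr0n.
  rewrite -ltNge subr0 expr2 => h.
  by rewrite ler_peMl ?normc_ge0// (le_trans M1)// ltW.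
have iZ (g : R[i] -> R) : (forall z, `|g z| <= normc z) ->
    measurable_fun setT (fun w => g (Z w)) ->
    P.-integrable setT (EFin \o (fun w => g (Z w))).
  move=> gn mg; apply: (@le_integrable _ _ _ _ _ measurableT _
    (EFin \o (fun w => 1 + normc (Z w) ^+ 2))).
  - exact/measurable_EFinP.
  - move=> w _ /=; rewrite lee_fin (le_trans (gn _))// ger0_norm; last first.
      by rewrite addr_ge0 ?sqr_ge0.
    by have := sqr_ge0 (normc (Z w) - 2^-1); lra.
  - rewrite (_ : _ \o _ = (fun w => (cst 1%:E w + (EFin \o (fun w => (normc (Z w) ^+ 2)%R)) w)%E))//.
    apply: integrableD => //.
    by apply: (@bounded_integrable _ _ _ P _ 1); [exact: measurable_cst|move=> w; rewrite normr1].
have part (g : R[i] -> R) : (forall z, `|g z| <= normc z) ->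
    (forall z w, g (z - w) = g z - g w) ->
    measurable_fun setT (fun w => g (Z w)) ->
    measurable_fun setT (fun w => g (truncate M (Z w))) ->
    \int[P]_w g (Z w) = 0 ->
    `|\int[P]_w g (truncate M (Z w))| <= tau.
  move=> gn gB mg mgt g0.
  have iz := iZ g gn mg.
  have it : P.-integrable setT (EFin \o (fun w => g (truncate M (Z w)))).
    apply: (@bounded_integrable _ _ _ P _ M) => // w.
    by rewrite (le_trans (gn _))// normc_truncate.
  rewrite -normrN -[X in `|X|]add0r -g0 -RintegralB//.
  rewrite (le_trans (le_normr_Rintegral _ _))//.
    rewrite (_ : _ \o _ = (fun w => ((EFin \o (fun w => g (Z w))) w -
       (EFin \o (fun w => g (truncate M (Z w)))) w)%E))//.
    exact: integrableB.
  have md : measurable_fun setT (fun w => `|g (Z w) - g (truncate M (Z w))|).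
    by apply: measurableT_comp => //; exact: measurable_funB.
  have : (mean (fun w => `|g (Z w) - g (truncate M (Z w))|) <= tau%:E)%E.
    apply: le_trans htau; apply: le_mean_ge0 => //; first exact: measurable_tail.
    by move=> w; rewrite -gB (le_trans (gn _)).
  rewrite /Rintegral /mean_ge0 => h; rewrite -lee_fin fineK//.
  rewrite ge0_fin_numE; first exact: le_lt_trans h (ltry _).
  by apply: integral_ge0 => w _; rewrite lee_fin.
have [EZ1 EZ2] : \int[P]_w complex.Re (Z w) = 0 /\ \int[P]_w complex.Im (Z w) = 0.
  by move: EZ; rewrite complex_integralE => -[].
have [mt1 mt2] := mt.
have h1 : `|\int[P]_w complex.Re (truncate M (Z w))| <= tau.
  by apply: part => // [z|z w]; [exact: Re_le_normc|rewrite ReD ReN].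
have h2 : `|\int[P]_w complex.Im (truncate M (Z w))| <= tau.
  by apply: part => // [z|z w]; [exact: Im_le_normc|rewrite ImD ImN].
have sq (u : R) : `|u| <= tau -> u ^+ 2 <= tau ^+ 2.
  by move=> ut; rewrite -real_normK ?num_real// ler_pXn2r// nnegrE.
by rewrite normc_sqr complex_integralE /=; have := sq _ h1; have := sq _ h2; lra.
Qed.

(** The last expectation is the price of replacing [Z] by [h Z] in a quadratic
    form, as [form_perturbation] will show with the same [eta].  It is small
    when first [eta], and then the tail, are chosen small; it also bounds the
    change of the second moment. *)
Lemma truncation (kappa : R) : 0 < kappa ->
  exists (h : R[i] -> R[i]) (K sigma2 eta : R),
  [/\ (forall d' (T' : measurableType d') (f : T' -> R[i]),
        cmeas f -> cmeas (fun w => h (f w))) /\ (forall z, normc (h z) <= K),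
      E (fun w => h (Z w)) = 0 /\
      E (fun w => (normc (h (Z w)) ^+ 2)%:C) = sigma2%:C,
      `|sigma2 - s ^+ 2| <= kappa, 0 < eta &
      (mean (fun w => eta * normc (Z w) ^+ 2 +
         (eta^-1 + 3) * normc (Z w - h (Z w)) ^+ 2) <= kappa%:E)%E].
Proof.
move=> k0.
have s1 : 0 < s ^+ 2 + 1 by rewrite ltr_wpDl ?sqr_ge0.
set eta := kappa / (2 * (s ^+ 2 + 1)).
have eta0 : 0 < eta by rewrite divr_gt0// mulr_gt0.
have e3 : 0 < eta^-1 + 3 by rewrite addr_gt0 ?invr_gt0.
(* The mean of [|Z - h Z|^2] will be at most [6 tau]: twice the tail, plus twice
   the square modulus of the mean of the truncation. *)
set tau := Order.min 1 (kappa / (12 * (eta^-1 + 3))).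
have tau0 : 0 < tau by rewrite lt_min ltr01 divr_gt0// mulr_gt0.
have tau1 : tau <= 1 by rewrite ge_min lexx.
have tau2 : tau * (12 * (eta^-1 + 3)) <= kappa.
  by rewrite -ler_pdivlMr ?mulr_gt0// ge_min lexx orbT.
have [M M1 hM] := tail_vanishes tau0.
have M0 : 0 <= M by exact: le_trans M1.
set m := E (fun w => truncate M (Z w)).
have m2 : normc m ^+ 2 <= 2 * tau.
  apply: le_trans (normc_centering M1 (ltW tau0) hM) _.
  by rewrite ler_pM2l// expr2 ler_piMl// ltW.
pose h z := truncate M z - m.
have bh z : normc (h z) <= M + normc m.
  by rewrite (le_trans (normc_sub _ _))// lerD2r normc_truncate.
have mh d' (T' : measurableType d') (f : T' -> R[i]) :
    cmeas f -> cmeas (fun w => h (f w)).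
  by move=> mf; apply: cmeasB; [exact: cmeas_truncate|exact: cmeas_cst].
have bt : cbdd (fun w => truncate M (Z w)).
  split; first exact: cmeas_truncate.
  by exists M => w; exact: normc_truncate.
have bhZ : cbdd (fun w => h (Z w)) by split; [exact: mh|exists (M + normc m) => w].
pose sigma2 := \int[P]_w normc (h (Z w)) ^+ 2.
pose g w := eta * normc (Z w) ^+ 2 + (eta^-1 + 3) * normc (Z w - h (Z w)) ^+ 2.
have mq : measurable_fun setT (fun w => normc (Z w) ^+ 2) by exact: cmeas_normc_sqr.
have mr : measurable_fun setT (fun w => normc (Z w - h (Z w)) ^+ 2).
  by apply: cmeas_normc_sqr; apply: cmeasB => //; exact: mh.
have mhq : measurable_fun setT (fun w => normc (h (Z w)) ^+ 2).
  by apply: cmeas_normc_sqr; exact: mh.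
have Mr : (mean (fun w => normc (Z w - h (Z w)) ^+ 2) <= (6 * tau)%:E)%E.
  apply: (@le_trans _ _ (mean (fun w => 2 * truncation_tail M w + 2 * (2 * tau)))).
    apply: le_mean_ge0 => //.
    - apply: measurable_funD; last exact: measurable_cst.
      by apply: measurable_funM; [exact: measurable_cst|exact: measurable_tail].
    - by move=> w; rewrite sqr_ge0.
    - move=> w; rewrite /h /truncation_tail opprB addrCA addrC.
      set c := Z w - _.
      have := normc_add c m; have := normc_ge0 (c + m).
      have := sqr_ge0 (normc c - normc m); move: m2.
      set cm := normc (c + m); set c' := normc c; set m' := normc m.
      by move=> ? ? ? ?; nra.
  rewrite mean_ge0D//; last 3 first.
  - by apply: measurable_funM; [exact: measurable_cst|exact: measurable_tail].
  - by move=> w; rewrite mulr_ge0// tail_ge0.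
  - by move=> w; rewrite !mulr_ge0// ltW.
  rewrite mean_ge0_cst mean_ge0Z//; last 2 first.
  - exact: measurable_tail.
  - by move=> w; exact: tail_ge0.
  apply: (@le_trans _ _ (2%:E * tau%:E + (2 * (2 * tau))%:E)%E).
    by rewrite leeD2r// lee_pmul2l.
  by rewrite -EFinM -EFinD lee_fin; lra.
have mg : measurable_fun setT g.
  by apply: measurable_funD; apply: measurable_funM => //; exact: measurable_cst.
have g0 w : 0 <= g w.
  by rewrite addr_ge0// mulr_ge0 ?sqr_ge0// ltW.
have Mg : (mean g <= kappa%:E)%E.
  rewrite mean_ge0D//; last 4 first.
  - by apply: measurable_funM => //; exact: measurable_cst.
  - by apply: measurable_funM => //; exact: measurable_cst.
  - by move=> w; rewrite mulr_ge0 ?sqr_ge0// ltW.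
  - by move=> w; rewrite mulr_ge0 ?sqr_ge0// ltW.
  rewrite !mean_ge0Z ?(ltW eta0) ?(ltW e3)//; [|by move=> w; rewrite sqr_ge0..].
  rewrite VZ -EFinM.
  apply: (@le_trans _ _ ((eta * s ^+ 2)%:E + (eta^-1 + 3)%:E * (6 * tau)%:E)%E).
    by rewrite leeD2l// lee_pmul2l.
  rewrite -EFinM -EFinD lee_fin.
  have : eta * s ^+ 2 <= kappa / 2.
    have : eta * (2 * (s ^+ 2 + 1)) = kappa by rewrite divfK// gt_eqF// mulr_gt0.
    by move: eta0; lra.
  by move: tau2; lra.
have diff w : `|normc (h (Z w)) ^+ 2 - normc (Z w) ^+ 2| <= g w.
  rewrite /g; set p := h (Z w); set q := Z w.
  have t1 := normc_add p (q - p); have t2 := normc_add q (p - q).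
  rewrite addrC subrK in t1; rewrite addrC subrK normc_subC in t2.
  have am : 2 * normc q * normc (q - p) <= eta * normc q ^+ 2 + eta^-1 * normc (q - p) ^+ 2.
    rewrite -subr_ge0.
    have -> : eta * normc q ^+ 2 + eta^-1 * normc (q - p) ^+ 2 - 2 * normc q * normc (q - p)
      = eta^-1 * (eta * normc q - normc (q - p)) ^+ 2.
      by field; rewrite gt_eqF.
    by rewrite mulr_ge0 ?sqr_ge0// invr_ge0 ltW.
  have := normc_ge0 p; have := normc_ge0 q; have := normc_ge0 (q - p).
  move: t1 t2 am; set a := normc p; set b := normc q; set c := normc (q - p).
  move=> t1 t2 am c0 b0 a0.
  have u1 : a ^+ 2 <= (b + c) ^+ 2 by rewrite ler_pXn2r ?nnegrE ?addr_ge0.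
  have u2 : b ^+ 2 <= (a + c) ^+ 2 by rewrite ler_pXn2r ?nnegrE ?addr_ge0.
  have u3 : a * c <= (b + c) * c by rewrite ler_wpM2r.
  by rewrite ler_norml; apply/andP; split; move: am u1 u2 u3 (sqr_ge0 c); lra.
have sE : mean (fun w => normc (h (Z w)) ^+ 2) = sigma2%:E.
  apply: (@mean_ge0_Rintegral _ _ _ P _ ((M + normc m) ^+ 2)) => // w.
  rewrite ger0_norm ?sqr_ge0// ler_pXn2r ?nnegrE ?normc_ge0 ?addr_ge0 ?normc_ge0//.
exists h, (M + normc m), sigma2, eta; split => //.
- split.
    transitivity (E (fun w => truncate M (Z w)) + E (fun=> - m)).
      by apply: complex_integralD => //; exact: cbdd_cst.
    by rewrite complex_integral_cst addrN.
  rewrite complex_integralE /=; congr (_ +i* _).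
  by rewrite Rintegral_cst// mul0r.
- rewrite ler_norml; apply/andP; split.
    suff : (mean (fun w => normc (Z w) ^+ 2) <= (sigma2 + kappa)%:E)%E.
      by rewrite VZ lee_fin; lra.
    apply: (@le_trans _ _ (mean (fun w => normc (h (Z w)) ^+ 2 + g w))).
      apply: le_mean_ge0 => //; first exact: measurable_funD.
        by move=> w; rewrite sqr_ge0.
      by move=> w; have := diff w; rewrite ler_norml => /andP[+ _]; lra.
    rewrite mean_ge0D// ?sE ?EFinD ?leeD2l//.
    by move=> w; rewrite sqr_ge0.
  suff : (mean (fun w => normc (h (Z w)) ^+ 2) <= (s ^+ 2 + kappa)%:E)%E.
    by rewrite sE lee_fin; lra.
  apply: (@le_trans _ _ (mean (fun w => normc (Z w) ^+ 2 + g w))).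
    apply: le_mean_ge0 => //; first exact: measurable_funD.
      by move=> w; rewrite sqr_ge0.
    by move=> w; have := diff w; rewrite ler_norml => /andP[_]; lra.
  rewrite mean_ge0D// ?VZ ?EFinD ?leeD2l//.
  by move=> w; rewrite sqr_ge0.
Qed.

End Truncation.

(** * Law of large numbers for the quadratic form *)

Section SameLaw.
Context {R : realType} d (T : measurableType d) (P : probability T R).
Variables (Z W : T -> R[i]).
Hypotheses (mZ : complex_rv Z) (mW : complex_rv W) (ZW : same_law P Z W).

Let of_pair (p : R * R) : R[i] := p.1 +i* p.2.

Lemma cmeas_of_pair : cmeas of_pair.
Proof. by split; [exact: measurable_fst|exact: measurable_snd]. Qed.

Let XZ : {mfun T >-> (R * R)%type} := HB.pack (reim \o Z) (isMeasurableFun.Build _ _ _ _ _ mZ).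
Let XW : {mfun T >-> (R * R)%type} := HB.pack (reim \o W) (isMeasurableFun.Build _ _ _ _ _ mW).

Lemma same_law_integral (f : R * R -> \bar R) :
  (\int[distribution P XZ]_p f p = \int[distribution P XW]_p f p)%E.
Proof. by apply: eq_measure_integral => A mA _; exact: ZW. Qed.

Lemma same_law_mean_ge0 (g : R[i] -> R) : (forall z, 0 <= g z) ->
  measurable_fun setT (g \o of_pair) ->
  mean_ge0 P (fun w => g (Z w)) = mean_ge0 P (fun w => g (W w)).
Proof.
move=> g0 mg.
have mf : measurable_fun setT (EFin \o (g \o of_pair)) by exact/measurable_EFinP.
have f0 p : (0 <= (EFin \o (g \o of_pair)) p)%E by rewrite lee_fin; exact: g0.
have := same_law_integral (EFin \o (g \o of_pair)).
rewrite (ge0_integral_distribution XZ mf f0) (ge0_integral_distribution XW mf f0).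
have eZ w : g (Z w) = (g \o of_pair) (reim (Z w)).
  by rewrite /of_pair /reim /=; case: (Z w).
have eW w : g (W w) = (g \o of_pair) (reim (W w)).
  by rewrite /of_pair /reim /=; case: (W w).
move=> h; rewrite /mean_ge0; under eq_integral do rewrite eZ.
by under [RHS]eq_integral do rewrite eW.
Qed.

Lemma same_law_complex_integral (g : R[i] -> R[i]) (M : R) :
  (forall z, normc (g z) <= M) -> cmeas (fun p => g (of_pair p)) ->
  complex_integral P (fun w => g (Z w)) = complex_integral P (fun w => g (W w)).
Proof.
move=> bg [mg1 mg2].
have part (k : R[i] -> R) : (forall z, `|k z| <= M) ->
    measurable_fun setT (k \o of_pair) ->
    \int[P]_w k (Z w) = \int[P]_w k (W w).
  move=> bk mk.
  have eZ w : k (Z w) = (k \o of_pair) (reim (Z w)).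
    by rewrite /of_pair /reim /=; case: (Z w).
  have eW w : k (W w) = (k \o of_pair) (reim (W w)).
    by rewrite /of_pair /reim /=; case: (W w).
  have mf : measurable_fun setT (EFin \o (k \o of_pair)) by exact/measurable_EFinP.
  have iZ : P.-integrable setT ((EFin \o (k \o of_pair)) \o XZ).
    apply: (@bounded_integrable _ _ _ P _ M); first exact: measurableT_comp.
    by move=> w; exact: bk.
  have iW : P.-integrable setT ((EFin \o (k \o of_pair)) \o XW).
    apply: (@bounded_integrable _ _ _ P _ M); first exact: measurableT_comp.
    by move=> w; exact: bk.
  have := same_law_integral (EFin \o (k \o of_pair)).
  rewrite (integral_distribution mf iZ) (integral_distribution mf iW).
  move=> h; rewrite /Rintegral; congr fine.
  under eq_integral do rewrite eZ.
  by under [RHS]eq_integral do rewrite eW.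
rewrite !complex_integralE; congr (_ +i* _).
  by apply: (part (fun z => complex.Re (g z))) => // z; exact: le_trans (Re_le_normc _) _.
by apply: (part (fun z => complex.Im (g z))) => // z; exact: le_trans (Im_le_normc _) _.
Qed.

End SameLaw.

Section ResolventEstimates.
Context {R : realType} (n : nat) (C : 'M[R[i]]_n) (z : R[i]).
Hypotheses (hC : C \is hermsymmx) (hz : 0 < complex.Im z).
Local Notation y := (complex.Im z).
Local Notation G := (resolvent C z).

(** Cauchy-Schwarz, [|R v| <= |v| / Im z], and the inequality of the means
    weighted by [eta]. *)
Lemma normc_dot_resolvent (u v : 'cV[R[i]]_n) (eta : R) : 0 < eta ->
  2 * normc (dot u (G *m v)) <= (eta * normsq u + eta^-1 * normsq v) / y.
Proof.
move=> e0; set c := normc _; set p := normsq u; set q := normsq v.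
have p0 : 0 <= p := normsq_ge0 u; have q0 : 0 <= q := normsq_ge0 v.
have c0 : 0 <= c := normc_ge0 _.
have cpq : (y * c) ^+ 2 <= p * q.
  rewrite exprMn (le_trans (ler_wpM2l (sqr_ge0 _) (cauchy_schwarz _ _)))//.
  by rewrite mulrCA ler_wpM2l// normsq_resolvent.
have r0 : 0 <= eta * p + eta^-1 * q.
  by rewrite addr_ge0// mulr_ge0// ?invr_ge0 ltW.
rewrite ler_pdivlMr// -(@ler_pXn2r _ 2) ?nnegrE ?mulr_ge0 ?(ltW hz)//.
apply: (@le_trans _ _ (4 * (p * q))).
  by move: cpq; rewrite !exprMn; lra.
rewrite -subr_ge0 (_ : _ - _ = (eta * p - eta^-1 * q) ^+ 2) ?sqr_ge0//.
by field; rewrite gt_eqF.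
Qed.

Lemma form_perturbation (u v : 'cV[R[i]]_n) (eta : R) : 0 < eta ->
  normc (dot u (G *m u) - dot (u - v) (G *m (u - v)))
    <= (eta * normsq u + (eta^-1 + 3) * normsq v) / y.
Proof.
move=> e0.
have -> : dot u (G *m u) - dot (u - v) (G *m (u - v)) =
    dot u (G *m v) + dot v (G *m u) - dot v (G *m v).
  by rewrite mulmxDr mulmxN !dot_lin; ring.
have h1 := normc_dot_resolvent u v e0.
have h2 := @normc_dot_resolvent v u eta^-1.
rewrite invr_gt0 invrK in h2; have {}h2 := h2 e0.
have h3 := normc_dot_resolvent v v ltr01.
rewrite (le_trans (normc_sub _ _))// (le_trans (lerD (normc_add _ _) (lexx _)))//.
have v0 : 0 <= normsq v / y by rewrite divr_ge0 ?normsq_ge0// ltW.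
rewrite invr1 in h3.
move: h1 h2 h3 v0; rewrite !mulrDl; lra.
Qed.

Lemma delta_col_normsq (j : 'I_n) : normsq (delta_mx j 0 : 'cV[R[i]]_n) = 1.
Proof.
rewrite /normsq (bigD1 j)//= big1 => [|i ij].
  by rewrite mxE !eqxx normc_real normr1 expr1n addr0.
by rewrite mxE (negbTE ij) normc_0 expr0n.
Qed.

(** Each column has norm at most [1 / Im z]. *)
Lemma resolvent_frobenius :
  \sum_(p : 'I_n * 'I_n) normc (G p.1 p.2) ^+ 2 <= n%:R / y ^+ 2.
Proof.
rewrite -(pair_big xpredT xpredT (fun i j => normc (G i j) ^+ 2))/= exchange_big /=.
apply: (@le_trans _ _ (\sum_(j < n) y ^- 2)); last first.
  by rewrite sumr_const card_ord -[leLHS]mulr_natl.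
apply: ler_sum => j _.
have := normsq_resolvent hC hz (delta_mx j 0).
rewrite delta_col_normsq -colE mulrC -ler_pdivlMr ?exprn_gt0// mul1r.
by apply: le_trans; apply: ler_sum => i _; rewrite mxE.
Qed.

Lemma normc_resolvent_entry i j : normc (G i j) <= y^-1.
Proof.
have := normsq_resolvent hC hz (delta_mx j 0).
rewrite delta_col_normsq -colE mulrC -ler_pdivlMr ?exprn_gt0// mul1r => h.
rewrite -(@ler_pXn2r _ 2) ?nnegrE ?normc_ge0 ?invr_ge0 ?(ltW hz)// exprVn.
apply: le_trans h; rewrite /normsq (bigD1 i)//= mxE lerDl.
by apply: sumr_ge0 => k _; rewrite sqr_ge0.
Qed.

Lemma normc_trace_resolvent : normc (\tr G) <= n%:R / y.
Proof.
rewrite (le_trans (normc_sum _ _))//.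
apply: (@le_trans _ _ (\sum_(j < n) y^-1)); last first.
  by rewrite sumr_const card_ord -[leLHS]mulr_natl.
by apply: ler_sum => i _; exact: normc_resolvent_entry.
Qed.

End ResolventEstimates.

Section RescaledColumn.
Context {R : realType} d (T : measurableType d) (n : nat) (x : nat -> T -> R[i]).

Lemma rescaled_colE w j : rescaled_col x n w j 0 =
  ((Num.sqrt n%:R)^-1)%:C * x j w.
Proof. by rewrite mxE. Qed.

Lemma normsq_rescaled_col w :
  normsq (rescaled_col x n w) = n%:R^-1 * \sum_(j < n) normc (x j w) ^+ 2.
Proof.
rewrite /normsq mulr_sumr; apply: eq_bigr => j _.
rewrite rescaled_colE normc_mul exprMn normc_real real_normK ?num_real//.
by rewrite exprVn sqr_sqrtr// ler0n.
Qed.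

Lemma rescaled_col_form w (A : 'M[R[i]]_n) :
  dot (rescaled_col x n w) (A *m rescaled_col x n w) =
  (n%:R^-1)%:C * \sum_(p : 'I_n * 'I_n) (x p.1 w)^* * x p.2 w * A p.1 p.2.
Proof.
rewrite -(pair_big xpredT xpredT (fun i j : 'I_n => (x i w)^* * x j w * A i j))/=.
rewrite /dot mulr_sumr; apply: eq_bigr => i _.
rewrite rescaled_colE mxE 2!mulr_sumr; apply: eq_bigr => j _.
have -> : (n%:R^-1)%:C = ((Num.sqrt n%:R)^-1)%:C * ((Num.sqrt n%:R)^-1)%:C :> R[i].
  by rewrite -(rmorphM (real_complex R)) -expr2 exprVn sqr_sqrtr// ler0n.
by rewrite rescaled_colE conjcM conjc_real; ring.
Qed.

End RescaledColumn.

Section QuadraticFormLaw.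
Context {R : realType} d (T : measurableType d) (P : probability T R).
Variables (x : nat -> T -> R[i]) (s : R).
Hypotheses (mx : forall j, complex_rv (x j)) (indx : mutually_independent P x)
  (lawx : forall i j, same_law P (x i) (x j))
  (Ex : forall j, complex_integral P (x j) = 0)
  (Vx : forall j, mean_ge0 P (fun w => normc (x j w) ^+ 2) = (s ^+ 2)%:E).
Local Notation mean f := (mean_ge0 P f%R).

Let cx j : cmeas (x j). Proof. exact/complex_rvP/mx. Qed.

Lemma markov_le (f : T -> R) (e c : R) : 0 < e -> measurable_fun setT f ->
  (forall w, 0 <= f w) -> (mean f <= c%:E)%E ->
  (P [set w | (e < f w)%R] <= (c / e)%:E)%E.
Proof.
move=> e0 mf f0 fc; have := le_trans (markov_ineq P e0 mf f0) fc.
by rewrite mulrC EFinM lee_pdivlMl.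
Qed.

Lemma cmeas_rescaled_col n : cmeas_mx (rescaled_col x n).
Proof.
move=> i j.
apply: (eq_cmeas (f := fun w => ((Num.sqrt n%:R)^-1)%:C * x i w)).
  by move=> w; rewrite mxE.
by apply: cmeasM => //; exact: cmeas_cst.
Qed.

Lemma mean_average n (F : nat -> T -> R) (c : R) :
  (forall j, measurable_fun setT (F j)) -> (forall j w, 0 <= F j w) ->
  0 <= c -> (forall j, (mean (F j) <= c%:E)%E) ->
  (mean (fun w => n.+1%:R^-1 * \sum_(j < n.+1) F j w) <= c%:E)%E.
Proof.
move=> mF F0 c0 hF; rewrite mean_ge0Z ?invr_ge0//; last 2 first.
- exact: measurable_sum.
- by move=> w; apply: sumr_ge0.
rewrite mean_ge0_sum//.
apply: (@le_trans _ _ ((n.+1%:R^-1)%:E * \sum_(j < n.+1) c%:E)%E).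
  rewrite lee_pmul2l ?lte_fin ?invr_gt0//.
  by apply: lee_sum => j _; exact: hF.
by rewrite sumEFin sumr_const card_ord -EFinM -(mulr_natl c) mulKf ?pnatr_eq0.
Qed.

Lemma normsq_rescaled_col_tight n (B : R) : 0 < B ->
  (P [set w | (B ^+ 2 < normsq (rescaled_col x n.+1 w))%R] <= (s ^+ 2 / B ^+ 2)%:E)%E.
Proof.
move=> B0; apply: markov_le; first by rewrite exprn_gt0.
- by apply: measurable_normsq; exact: cmeas_rescaled_col.
- by move=> w; exact: normsq_ge0.
rewrite (_ : (fun w => _) = (fun w => n.+1%:R^-1 * \sum_(j < n.+1) normc (x j w) ^+ 2)).
  apply: (@mean_average n (fun j w => normc (x j w) ^+ 2)).
  - by move=> j; exact: cmeas_normc_sqr.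
  - by move=> j w; rewrite sqr_ge0.
  - by rewrite sqr_ge0.
  - by move=> j; rewrite Vx.
by apply/funext => w; rewrite normsq_rescaled_col.
Qed.

Variable C : forall N : nat, T -> 'M[R[i]]_N.+1.
Hypotheses (mC : forall N i j, complex_rv (fun w => C N w i j))
  (hC : forall N w, C N w \is hermsymmx)
  (indC : forall N, independent_systems P
     (generated_by x) (generated_by_entries (C N))).
Variable z : R[i].
Hypothesis hz : 0 < complex.Im z.
Local Notation y := (complex.Im z).

Let res N w := resolvent (C N w) z.

Definition deviation N w : R[i] :=
  dot (rescaled_col x N.+1 w) (res N w *m rescaled_col x N.+1 w)
    - (s ^+ 2 / N.+1%:R)%:C * \tr (res N w).

Let mCmx N : cmeas_mx (C N).
Proof. by move=> i j; exact/complex_rvP. Qed.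

Let mres N : cmeas_mx (res N).
Proof. exact: cmeas_resolvent. Qed.

Lemma cmeas_trace_resolvent N : cmeas (fun w => \tr (res N w)).
Proof. by apply: cmeas_sum => i; exact: mres. Qed.

Lemma cmeas_deviation N : cmeas (deviation N).
Proof.
apply: cmeasB.
  apply: cmeas_dot; first exact: cmeas_rescaled_col.
  by apply: cmeas_mulmx => //; exact: cmeas_rescaled_col.
by apply: cmeasM; [exact: cmeas_cst|exact: cmeas_trace_resolvent].
Qed.

Section Truncated.
Variables (h : R[i] -> R[i]) (K sigma2 eta kappa : R).
Hypothesis mh : forall d' (T' : measurableType d') (f : T' -> R[i]),
  cmeas f -> cmeas (fun w => h (f w)).
Hypothesis bh : forall u, normc (h u) <= K.
Hypothesis Eh : forall j, complex_integral P (fun w => h (x j w)) = 0.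
Hypothesis Eh2 : forall j,
  complex_integral P (fun w => (normc (h (x j w)) ^+ 2)%:C) = sigma2%:C.
Hypotheses (sig : `|sigma2 - s ^+ 2| <= kappa) (eta0 : 0 < eta).

Let cost j w := eta * normc (x j w) ^+ 2 + (eta^-1 + 3) * normc (x j w - h (x j w)) ^+ 2.
Hypothesis hcost : forall j, (mean (cost j) <= kappa%:E)%E.

Let error N w := N.+1%:R^-1 * \sum_(j < N.+1) cost j w.
Let form N := centered_form x h sigma2 (n := N.+1) (res N).

Let kappa0 : 0 <= kappa. Proof. exact: le_trans sig. Qed.

Lemma truncation_cost_ge0 j w : 0 <= cost j w.
Proof.
have e0 : 0 < eta^-1 by rewrite invr_gt0.
by rewrite addr_ge0// mulr_ge0 ?sqr_ge0// ltW// addr_gt0.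
Qed.

Lemma measurable_truncation_cost j : measurable_fun setT (cost j).
Proof.
apply: measurable_funD; apply: measurable_funM => //; apply: cmeas_normc_sqr => //.
by apply: cmeasB => //; exact: mh.
Qed.

(** The three terms are the cost of truncating the column, the cost of replacing
    [s^2] by [sigma2], and the centered form of the truncated column. *)
Lemma deviation_le N w : normc (deviation N w) <=
  error N w / y + kappa / y + normc (form N w) / N.+1%:R.
Proof.
set b := rescaled_col x N.+1 w.
set b' := rescaled_col (fun j w => h (x j w)) N.+1 w.
set b'' := rescaled_col (fun j w => x j w - h (x j w)) N.+1 w.
have b'E : b' = b - b''.
  by apply/matrixP => i j; rewrite !mxE; ring.
have e1 : normc (dot b (res N w *m b) - dot b' (res N w *m b')) <= error N w / y.
  have := form_perturbation (hC N w) hz b b'' eta0; rewrite -b'E => /le_trans; apply.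
  rewrite ler_pM2r ?invr_gt0// !normsq_rescaled_col /error /cost.
  rewrite !mulr_sumr -big_split /=.
  by apply: ler_sum => j _; rewrite le_eqVlt; apply/orP; left; apply/eqP; ring.
have e2 : normc ((sigma2 - s ^+ 2)%:C * ((N.+1%:R^-1)%:C * \tr (res N w))) <= kappa / y.
  rewrite !normc_mul !normc_real ler_pM ?mulr_ge0 ?normc_ge0//.
  rewrite ger0_norm ?invr_ge0// mulrC ler_pdivrMr//.
  by rewrite mulrC; exact: normc_trace_resolvent.
have fE : dot b' (res N w *m b') - (sigma2)%:C * ((N.+1%:R^-1)%:C * \tr (res N w)) =
    (N.+1%:R^-1)%:C * form N w.
  rewrite rescaled_col_form mulrCA -mulrBr; congr (_ * _).
  rewrite /form /centered_form.
  under [RHS]eq_bigr do rewrite /centered_product mulrBl.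
  rewrite sumrB; congr (_ - _).
  rewrite -(pair_big xpredT xpredT (fun i j : 'I_N.+1 =>
    (if (i == j :> nat) then sigma2%:C else 0) * res N w i j))/=.
  rewrite /mxtrace mulr_sumr; apply: eq_bigr => i _.
  rewrite (bigD1 i)//= eqxx big1 ?addr0// => j ij.
  by rewrite ifN ?mul0r// eq_sym.
have -> : deviation N w = (dot b (res N w *m b) - dot b' (res N w *m b'))
   + (sigma2 - s ^+ 2)%:C * ((N.+1%:R^-1)%:C * \tr (res N w))
   + (N.+1%:R^-1)%:C * form N w.
  rewrite -fE /deviation -/b (rmorphM (real_complex R)) (rmorphB (real_complex R)) /=.
  ring.
rewrite (le_trans (normc_add _ _))// lerD//.
  by rewrite (le_trans (normc_add _ _))// lerD.
by rewrite normc_mul normc_real ger0_norm ?invr_ge0// mulrC.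
Qed.

Let L := K ^+ 2 + `|sigma2|.

Let GC N : set (set T) := \bigcup_(ij : 'I_N.+1 * 'I_N.+1)
  preimage_set_system setT (reim \o (fun w => C N w ij.1 ij.2)) measurable.

Let GCm N : GC N `<=` measurable.
Proof. by move=> _ [ij _ [A mA <-]]; exact: mC. Qed.

Let bA N i j : cbdd ((fun w => res N w i j) : g_sigma_algebraType (@GC N) -> R[i]).
Proof.
split; last by exists y^-1 => w; exact: normc_resolvent_entry.
apply: cmeas_resolvent => //.
move=> k l; apply/complex_rvP => _ A mA.
by apply: sub_sigma_algebra; exists (k, l) => //; exists A.
Qed.

Lemma form_tail N (e : R) : 0 < e ->
  (P [set w | (e < normc (form N w) / N.+1%:R)%R]
    <= (2 * L ^+ 2 / y ^+ 2 / e ^+ 2 / N.+1%:R)%:E)%E.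
Proof.
move=> e0.
have n0 : 0 < N.+1%:R :> R by rewrite ltr0n.
have bf : cbdd (form N).
  apply: cbdd_sum => p; apply: cbddM; first exact: (cbdd_centered_product mx sigma2 mh bh).
  exact: cbdd_sub (@GCm N) (bA _ _).
have mf : measurable_fun setT (fun w => normc (form N w) ^+ 2).
  by apply: cmeas_normc_sqr; case: bf.
have -> : [set w | e < normc (form N w) / N.+1%:R] =
    [set w | (e * N.+1%:R) ^+ 2 < normc (form N w) ^+ 2].
  apply/seteqP; split => w /=; rewrite ltr_pdivlMr// ltr_pXn2r// ?nnegrE ?normc_ge0//;
  by rewrite mulr_ge0// ltW.
apply: (@le_trans _ _ ((2 * L ^+ 2 * (N.+1%:R / y ^+ 2)) / (e * N.+1%:R) ^+ 2)%:E).
  apply: markov_le => //; first by rewrite exprn_gt0// mulr_gt0.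
    by move=> w; rewrite sqr_ge0.
  have [M hM] := bf.2.
  rewrite (@mean_ge0_Rintegral _ _ _ P _ (M ^+ 2))//; last first.
    move=> w; rewrite ger0_norm ?sqr_ge0// ler_pXn2r ?nnegrE ?normc_ge0//.
    exact: le_trans (normc_ge0 (form N w)) _.
  rewrite lee_fin.
  have := @variance_centered_form _ _ _ P x mx indx h K sigma2 mh bh Eh Eh2
    (@GC N) N.+1 (res N) (N.+1%:R / y ^+ 2) (@GCm N) (@indC N) (@bA N).
  apply => w; exact: resolvent_frobenius.
rewrite lee_fin le_eqVlt; apply/orP; left; apply/eqP.
by field; rewrite !gt_eqF.
Qed.

Lemma deviation_tail N (e : R) : 0 < e -> kappa / y <= e / 3 ->
  (P [set w | (e < normc (deviation N w))%R]
    <= (kappa / (y * (e / 3)) + 2 * L ^+ 2 / y ^+ 2 / (e / 3) ^+ 2 / N.+1%:R)%:E)%E.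
Proof.
move=> e0 ke.
have e3 : 0 < e / 3 by rewrite divr_gt0.
have merr : measurable_fun setT (error N).
  apply: measurable_funM; first exact: measurable_cst.
  by apply: measurable_sum => j; exact: measurable_truncation_cost.
have mA : measurable [set w | y * (e / 3) < error N w].
  by apply: measurable_ltr_set => //; exact: measurable_cst.
have mB : measurable [set w | e / 3 < normc (form N w) / N.+1%:R].
  apply: measurable_ltr_set; first exact: measurable_cst.
  apply: measurable_funM; last exact: measurable_cst.
  apply: cmeas_normc; apply: cmeas_sum => p; apply: cmeasM; last exact: mres.
  by have [] := cbdd_centered_product mx sigma2 mh bh p.1 p.2.
apply: (@le_trans _ _ (P ([set w | (y * (e / 3) < error N w)%R] `|`
   [set w | (e / 3 < normc (form N w) / N.+1%:R)%R]))).
  apply: le_measure.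
  - apply/mem_set; by apply: measurable_ltr_set; [exact: measurable_cst|apply: cmeas_normc; exact: cmeas_deviation].
  - by apply/mem_set; exact: measurableU.
  move=> w /= hw; have := deviation_le N w.
  have [h1 _|h1] := ltP (y * (e / 3)) (error N w); first by left.
  move=> h2; right; move: hw h2 ke.
  have : error N w / y <= e / 3 by rewrite ler_pdivrMr// mulrC.
  move: (error N w / y) (kappa / y) (normc (form N w) / _) (normc (deviation N w)) => p1 p2 p3 p4.
  by move: e0; lra.
rewrite EFinD; apply: (le_trans (measureU2 _ _ _)) => //.
apply: leeD; last exact: form_tail.
apply: markov_le => //; first by rewrite mulr_gt0.
  by move=> w; rewrite mulr_ge0 ?invr_ge0//; apply: sumr_ge0 => j _; exact: truncation_cost_ge0.
apply: mean_average => //; first exact: measurable_truncation_cost.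
exact: truncation_cost_ge0.
Qed.

End Truncated.

(** The first term of [deviation_tail] does not depend on [N] and is made small by
    the truncation; the second one then vanishes as [N] grows. *)
Lemma deviation_cvg0 (e : R) : 0 < e ->
  P [set w | e < normc (deviation N w)] @[N --> \oo] --> 0%E.
Proof.
move=> e0; apply: near_le_cvg0 => // r r0.
pose kappa := Order.min (y * (e / 3)) (r / 2 * (y * (e / 3))).
have ye0 : 0 < y * (e / 3) by rewrite mulr_gt0// divr_gt0.
have k0 : 0 < kappa by rewrite lt_min ye0 mulr_gt0// divr_gt0.
have k1 : kappa / y <= e / 3 by rewrite ler_pdivrMr// mulrC ge_min lexx.
have k2 : kappa / (y * (e / 3)) <= r / 2.
  by rewrite ler_pdivrMr// ge_min lexx orbT.
have [h [K [sigma2 [eta [[mh bh] [Eh Eh2] sig eta0 hg]]]]] :=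
  truncation (cx 0%N) (Ex 0%N) (Vx 0%N) k0.
have hpair := mh _ _ _ (cmeas_of_pair (R := R)).
have Ehj j : complex_integral P (fun w => h (x j w)) = 0.
  by rewrite (same_law_complex_integral (mx j) (mx 0%N) (lawx j 0%N) bh).
have Eh2j j : complex_integral P (fun w => (normc (h (x j w)) ^+ 2)%:C) = sigma2%:C.
  rewrite (same_law_complex_integral (g := fun u => (normc (h u) ^+ 2)%:C)
    (M := K ^+ 2) (mx j) (mx 0%N) (lawx j 0%N))//.
    move=> u; rewrite normc_real ger0_norm ?sqr_ge0// ler_pXn2r ?nnegrE ?normc_ge0//.
    exact: le_trans (normc_ge0 (h u)) _.
  by apply: cmeas_real; exact: cmeas_normc_sqr.
have hgj j : (mean (fun w => (eta * normc (x j w) ^+ 2 +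
    (eta^-1 + 3) * normc (x j w - h (x j w)) ^+ 2)) <= kappa%:E)%E.
  rewrite (same_law_mean_ge0 (g := fun u => eta * normc u ^+ 2 +
    (eta^-1 + 3) * normc (u - h u) ^+ 2) (mx j) (mx 0%N) (lawx j 0%N))//.
    have e1 : 0 < eta^-1 by rewrite invr_gt0.
    by move=> u; rewrite addr_ge0// mulr_ge0 ?sqr_ge0// ltW// addr_gt0.
  apply: measurable_funD; apply: measurable_funM => //.
    by apply: cmeas_normc_sqr; exact: cmeas_of_pair.
  by apply: cmeas_normc_sqr; apply: cmeasB => //; exact: cmeas_of_pair.
set c := 2 * (K ^+ 2 + `|sigma2|) ^+ 2 / y ^+ 2 / (e / 3) ^+ 2.
have r2 : 0 < r / 2 by rewrite divr_gt0.
near=> N.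
apply: (le_trans (deviation_tail mh bh Ehj Eh2j sig eta0 hgj N e0 k1)).
rewrite lee_fin [leRHS](splitr r) lerD// -/c.
rewrite ler_pdivrMr// mulrC -ler_pdivrMr//.
apply: (@le_trans _ _ N%:R); last by rewrite ler_nat.
near: N; exact: nbhs_infty_ger.
Unshelve. all: by end_near. Qed.

End QuadraticFormLaw.

(** * The trace of the resolvent *)

Section EmpiricalStieltjes.
Context {R : realType} (n : nat).

(** Diagonalize [C]; unique factorization of the characteristic polynomial
    matches the diagonal with [l] up to order. *)
Lemma trace_resolvent (C : 'M[R[i]]_n) (l : n.-tuple R) z :
  C \is hermsymmx -> 0 < complex.Im z -> ordered_eigenvalues C l ->
  \tr (resolvent C z) = \sum_(t <- l) (t%:C - z)^-1.
Proof.
move=> hC hz [_ charC].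
have /orthomx_spectralP := hermitian_normalmx hC.
set U := spectralmx C; set sp := spectral_diag C => CE.
have uU : U \in unitmx by exact: spectral_unit.
have charE : char_poly C = \prod_(i < n) ('X - (sp 0 i)%:P).
  transitivity (char_poly (diag_mx sp)); last first.
    rewrite char_poly_trig ?diag_mx_is_trig//.
    by apply: eq_bigr => i _; rewrite mxE eqxx mulr1n.
  pose V := map_mx (@polyC R[i]) U; pose V' := map_mx (@polyC R[i]) (invmx U).
  have V'V : V' *m V = 1%:M by rewrite /V' /V -map_mxM mulVmx// map_mx1.
  have -> : char_poly C = \det (V' *m char_poly_mx (diag_mx sp) *m V).
    congr (\det _); rewrite [in LHS]CE /char_poly_mx mulmxBr mulmxBl.
    by rewrite mul_mx_scalar -scalemxAl V'V scalemx1 !map_mxM.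
  by rewrite !det_mulmx mulrAC -det_mulmx V'V det1 mul1r.
have perm : perm_eq [seq t%:C | t <- l] [seq sp 0 i | i <- index_enum 'I_n].
  by apply: prod_XsubC_eq; rewrite !big_map -charC charE.
have sz i : sp 0 i - z != 0.
  have : sp 0 i \in [seq t%:C | t <- l].
    by rewrite (perm_mem perm) map_f// mem_index_enum.
  move=> /mapP[t _ ->]; apply: contraTneq hz => /eqP.
  rewrite subr_eq0 => /eqP <- /=; by rewrite ltxx.
have resE : resolvent C z = invmx U *m diag_mx (\row_i (sp 0 i - z)^-1) *m U.
  have uC : C - z%:M \in unitmx by exact: resolvent_unit.
  rewrite /resolvent -[LHS]mulmx1 -[RHS](mulKmx uC); congr (_ *m _).
  have -> : C - z%:M = invmx U *m (diag_mx sp - z%:M) *m U.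
    by rewrite mulmxBr mulmxBl mul_mx_scalar -scalemxAl mulVmx// scalemx1 -CE.
  rewrite !mulmxA mulmxK// -(mulmxA (invmx U)).
  have -> : (diag_mx sp - z%:M) *m diag_mx (\row_i (sp 0 i - z)^-1) = 1%:M.
    have -> : diag_mx sp - z%:M = diag_mx (\row_i (sp 0 i - z)).
      apply/matrixP => i j; rewrite !mxE; case: eqP => [->|_]; first by rewrite !mulr1n.
      by rewrite !mulr0n subr0.
    rewrite mulmx_diag; apply/matrixP => i j; rewrite !mxE mulfV//.
  by rewrite mulmx1 mulVmx.
rewrite resE mxtrace_mulC mulmxA mulmxV// mul1mx mxtrace_diag.
have := perm_big _ perm (F := fun u : R[i] => (u - z)^-1) (P := xpredT) (op := +%R) (x := 0).
rewrite !big_map => ->.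
by apply: eq_bigr => i _; rewrite mxE.
Qed.

Lemma empirical_ge0_integral (l : n.-tuple R) (f : R -> R) :
  measurable_fun setT f -> (forall t, 0 <= f t) ->
  (\int[empirical_measure l]_t (f t)%:E)%E = (n%:R^-1 * \sum_(t <- l) f t)%:E.
Proof.
move=> mf f0; have mfE : measurable_fun setT (EFin \o f) by exact/measurable_EFinP.
rewrite ge0_integral_mscale//; last by move=> t _; rewrite lee_fin.
rewrite ge0_integral_measure_sum//; last by move=> t _; rewrite lee_fin.
under eq_bigr do rewrite integral_dirac// diracT mul1e.
rewrite sumEFin -EFinM; congr (_ * _)%:E.
rewrite (big_nth 0) size_tuple big_mkord.
by apply: eq_bigr.
Qed.

(** Adding the bound [M] reduces the claim to nonnegative functions. *)
Lemma empirical_integral (l : n.-tuple R) (f : R -> R) (M : R) :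
  measurable_fun setT f -> (forall t, `|f t| <= M) ->
  \int[empirical_measure l]_(t in setT) f t = n%:R^-1 * \sum_(t <- l) f t.
Proof.
move=> mf bf.
have M0 : 0 <= M by exact: le_trans (bf 0).
have mass : (empirical_measure l setT < +oo)%E.
  rewrite -[X in (X < _)%E]mul1e -integral_cst//.
  by rewrite (empirical_ge0_integral l (f := fun=> 1))// ltry.
have bint (g : R -> R) (K : R) : measurable_fun setT g -> (forall t, `|g t| <= K) ->
    (empirical_measure l).-integrable setT (EFin \o g).
  move=> mg bg; apply: measurable_bounded_integrable => //.
  by exists K; split; [exact: num_real|move=> x Kx t _; exact: le_trans (bg t) (ltW Kx)].
have ge0 (g : R -> R) : measurable_fun setT g -> (forall t, 0 <= g t) ->
    \int[empirical_measure l]_(t in setT) g t = n%:R^-1 * \sum_(t <- l) g t.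
  by move=> mg g0; rewrite /Rintegral empirical_ge0_integral.
transitivity (\int[empirical_measure l]_(t in setT) ((f t + M) - M)).
  by apply: eq_Rintegral => t _; rewrite addrK.
rewrite RintegralB//; last 2 first.
- apply: (bint _ (M + M)); first exact: measurable_funD.
  by move=> t; rewrite (le_trans (ler_normD _ _))// lerD// ger0_norm.
- by apply: (bint _ M) => // t; rewrite ger0_norm.
rewrite !ge0//; last first.
- by move=> t; have := bf t; rewrite ler_norml => /andP[]; lra.
- exact: measurable_funD.
by rewrite -mulrBr -sumrB; congr (_ * _); apply: eq_bigr => t _; rewrite addrK.
Qed.

End EmpiricalStieltjes.

Section ResolventKernel.
Context {R : realType} (z : R[i]).
Hypothesis hz : 0 < complex.Im z.

Definition resolvent_kernel (t : R) : R[i] := (t%:C - z)^-1.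

Lemma Im_kernel_den t : complex.Im (t%:C - z) = - complex.Im z.
Proof. by rewrite ImD ImN /= add0r. Qed.

Lemma kernel_den_gt0 t : 0 < normc (t%:C - z) ^+ 2.
Proof.
rewrite normc_sqr Im_kernel_den sqrrN ltr_wpDl ?sqr_ge0// exprn_gt0//.
Qed.

Lemma normc_kernel t : normc (resolvent_kernel t) <= (complex.Im z)^-1.
Proof.
have d0 : 0 < normc (t%:C - z).
  by rewrite lt_def normc_ge0 andbT -sqrf_eq0 gt_eqF// kernel_den_gt0.
rewrite normc_inv lef_pV2 ?posrE//.
rewrite (le_trans _ (Im_le_normc _))// Im_kernel_den normrN ler_norm//.
Qed.

Let continuous_den : continuous (fun t : R => normc (t%:C - z) ^+ 2).
Proof.
have -> : (fun t : R => normc (t%:C - z) ^+ 2) =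
    (fun t => (t - complex.Re z) * (t - complex.Re z) + complex.Im z ^+ 2).
  by apply/funext => t; rewrite normc_sqr Im_kernel_den ReD ReN /=; ring.
move=> t; apply: cvgD; last exact: cvg_cst.
by apply: cvgM; apply: cvgB => //; exact: cvg_cst.
Qed.

Lemma continuous_Re_kernel : continuous (fun t => complex.Re (resolvent_kernel t)).
Proof.
have -> : (fun t => complex.Re (resolvent_kernel t)) =
    (fun t => (t - complex.Re z) * (normc (t%:C - z) ^+ 2)^-1).
  by apply/funext => t; rewrite /resolvent_kernel Re_inv ReD ReN.
move=> t; apply: cvgM; first by apply: cvgB => //; exact: cvg_cst.
by apply: cvgV; [rewrite gt_eqF// kernel_den_gt0|exact: continuous_den].
Qed.

Lemma continuous_Im_kernel : continuous (fun t => complex.Im (resolvent_kernel t)).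
Proof.
have -> : (fun t => complex.Im (resolvent_kernel t)) =
    (fun t => complex.Im z * (normc (t%:C - z) ^+ 2)^-1).
  by apply/funext => t; rewrite /resolvent_kernel Im_inv Im_kernel_den mulNr opprK.
move=> t; apply: cvgM; first exact: cvg_cst.
by apply: cvgV; [rewrite gt_eqF// kernel_den_gt0|exact: continuous_den].
Qed.

Lemma bounded_Re_kernel : bounded_fun (fun t => complex.Re (resolvent_kernel t)).
Proof.
exists (complex.Im z)^-1; split; first exact: num_real.
move=> x xK t _; apply: le_trans (ltW xK).
exact: le_trans (Re_le_normc _) (normc_kernel t).
Qed.

Lemma bounded_Im_kernel : bounded_fun (fun t => complex.Im (resolvent_kernel t)).
Proof.
exists (complex.Im z)^-1; split; first exact: num_real.
move=> x xK t _; apply: le_trans (ltW xK).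
exact: le_trans (Im_le_normc _) (normc_kernel t).
Qed.

End ResolventKernel.

Section TraceConvergence.
Context {R : realType} d (T : measurableType d) (P : probability T R).
Variable C : forall N : nat, T -> 'M[R[i]]_N.+1.
Variable lambda : forall N : nat, T -> N.+1.-tuple R.
Variable mu0 : {finite_measure set R -> \bar R}.
Hypotheses (mC : forall N i j, complex_rv (fun w => C N w i j))
  (hC : forall N w, C N w \is hermsymmx)
  (hlambda : forall N w, ordered_eigenvalues (C N w) (lambda N w))
  (weak : weak_cvg_in_probability P
     (fun N w => empirical_measure (lambda N w)) mu0).
Variable z : R[i].
Hypothesis hz : 0 < complex.Im z.

Definition trace_error N w : R[i] :=
  (N.+1%:R^-1)%:C * \tr (resolvent (C N w) z) - stieltjes mu0 z.

Lemma trace_errorE N w : trace_error N w =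
  complex_integral (empirical_measure (lambda N w)) (resolvent_kernel z) - stieltjes mu0 z.
Proof.
rewrite /trace_error; congr (_ - _).
have bRe t := le_trans (Re_le_normc _) (normc_kernel hz t).
have bIm t := le_trans (Im_le_normc _) (normc_kernel hz t).
have mRe := continuous_measurable_fun (continuous_Re_kernel hz).
have mIm := continuous_measurable_fun (continuous_Im_kernel hz).
rewrite (trace_resolvent (hC N w) hz (hlambda N w)) /complex_integral.
rewrite (empirical_integral _ mRe bRe) (empirical_integral _ mIm bIm).
apply/eqP; rewrite eq_complex ReM ImM /= !mul0r subr0 addr0 Re_sum Im_sum.
by rewrite !eqxx.
Qed.

Lemma trace_error_cvg0 (e : R) : 0 < e ->
  P [set w | e < normc (trace_error N w)] @[N --> \oo] --> 0%E.
Proof.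
move=> e0.
have e2 : 0 < e / 2 by rewrite divr_gt0.
have [mRe cRe] := weak (continuous_Re_kernel hz) (bounded_Re_kernel hz).
have [mIm cIm] := weak (continuous_Im_kernel hz) (bounded_Im_kernel hz).
have ReE N w : complex.Re (trace_error N w) =
    \int[empirical_measure (lambda N w)]_(t in setT) complex.Re (resolvent_kernel z t) -
    \int[mu0]_(t in setT) complex.Re (resolvent_kernel z t).
  by rewrite trace_errorE ReD ReN.
have ImE N w : complex.Im (trace_error N w) =
    \int[empirical_measure (lambda N w)]_(t in setT) complex.Im (resolvent_kernel z t) -
    \int[mu0]_(t in setT) complex.Im (resolvent_kernel z t).
  by rewrite trace_errorE ImD ImN.
have mE N : cmeas (trace_error N).
  split.
    under eq_fun do rewrite ReE.
    by apply: measurable_funB => //; exact: measurable_cst.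
  under eq_fun do rewrite ImE.
  by apply: measurable_funB => //; exact: measurable_cst.
apply: near_le_cvg0 => // r r0.
have r2 : 0 < r / 2 by rewrite divr_gt0.
have nRe := cvg0_near_le (cRe _ e2) r2.
have nIm := cvg0_near_le (cIm _ e2) r2.
near=> N.
have hRe : (P [set w | (e / 2 < `|complex.Re (trace_error N w)|)%R] <= (r / 2)%:E)%E.
  by under eq_set do rewrite ReE; near: N.
have hIm : (P [set w | (e / 2 < `|complex.Im (trace_error N w)|)%R] <= (r / 2)%:E)%E.
  by under eq_set do rewrite ImE; near: N.
have [mE1 mE2] := mE N.
have mA : measurable [set w | e / 2 < `|complex.Re (trace_error N w)|].
  by apply: measurable_ltr_set; [exact: measurable_cst|exact: measurableT_comp].
have mB : measurable [set w | e / 2 < `|complex.Im (trace_error N w)|].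
  by apply: measurable_ltr_set; [exact: measurable_cst|exact: measurableT_comp].
rewrite [r in (r%:E)](splitr r) EFinD; apply: le_trans (leeD hRe hIm).
apply: le_trans (measureU2 _ mA mB); apply: le_measure.
- apply/mem_set; apply: measurable_ltr_set; first exact: measurable_cst.
  exact: cmeas_normc.
- by apply/mem_set; exact: measurableU.
move=> w /= hw.
have [h1|h1] := ltP (e / 2) `|complex.Re (trace_error N w)|; first by left.
right; rewrite ltNge; apply/negP => h2; move: hw; apply/negP; rewrite -leNgt.
rewrite [trace_error N w]complexE (le_trans (normc_add _ _))// normc_mul.
rewrite !normc_real /= expr0n add0r expr1n sqrtr1 mul1r.
by rewrite (splitr e) lerD.
Unshelve. all: by end_near. Qed.

End TraceConvergence.

(** * Convergence of the eigenvalue *)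

Section Assembly.
Context {R : realType} d (T : measurableType d) (P : probability T R).

Lemma probability_le_union3 (A B D E : set T) (r : R) :
  measurable A -> measurable B -> measurable D -> measurable E ->
  E `<=` A `|` B `|` D ->
  (P A <= (r / 3)%:E)%E -> (P B <= (r / 3)%:E)%E -> (P D <= (r / 3)%:E)%E ->
  (P E <= r%:E)%E.
Proof.
move=> mA mB mD mE sub hA hB hD.
rewrite (_ : r = r / 3 + r / 3 + r / 3); last by lra.
rewrite 2!EFinD; apply: le_trans (leeD (leeD hA hB) hD).
have mAB : measurable (A `|` B) by exact: measurableU.
apply: le_trans (leeD (measureU2 _ mA mB) (lexx (P D))).
apply: le_trans (measureU2 _ mAB mD); apply: le_measure => //; apply/mem_set => //.
exact: measurableU.
Qed.

End Assembly.

(* MathComp-Analysis.  The index N : nat stands for the matrix size N.+1 >= 1,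
   and x j stands for the entry number j.+1 of the infinite column (x_{j0}). *)
Theorem theorem6 (R : realType) (d : measure_display) (T : measurableType d)
  (P : probability T R)
  (s : R) (theta : R)
  (a : nat -> T -> R)
  (x : nat -> T -> R[i])
  (C : forall N : nat, T -> 'M[R[i]]_N.+1)
  (lambda : forall N : nat, T -> N.+1.-tuple R)
  (mu0 : {finite_measure set R -> \bar R})
  (beta : nat -> T -> R[i]) (beta0 : R[i])
  (hs : 0 <= s)
  (htheta : 0 < theta < pi / 2)
  (ha : forall N, measurable_fun setT (a N))
  (hC : forall N i j, complex_rv (fun w => C N w i j))
  (hCherm : forall N w, C N w \is hermsymmx)
  (hR0_indep : forall N, independent_systems P
     (g_sigma_algebra_preimage (a N))
     <<s generated_by_entries (rescaled_col x N.+1) `|`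
         generated_by_entries (C N) >>)
  (hR0_cvg : cvg_in_probability P a 0)
  (hR1_rv : forall j, complex_rv (x j))
  (hR1_indep : mutually_independent P x)
  (hR1_law : forall i j, same_law P (x i) (x j))
  (hR1_indepC : forall N, independent_systems P
     (generated_by x) (generated_by_entries (C N)))
  (hR1_mean : forall j, complex_integral P (x j) = 0)
  (hR1_var : forall j,
     'E_P[fun w => (Normc.normc (x j w) ^+ 2)%R]%E = (s ^+ 2)%:E)
  (hlambda : forall N w, ordered_eigenvalues (C N w) (lambda N w))
  (hR2 : weak_cvg_in_probability P
     (fun N w => empirical_measure (lambda N w)) mu0)
  (hbeta : forall N w, nonpositive_type_eigenvalue
     (pontryagin_mx N.+1)
     (bordered_mx (a N w) (rescaled_col x N.+1 w) (C N w))
     (beta N w))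
  (hbeta0 : gznt theta (fun z => - z + (s ^+ 2)%:C * stieltjes mu0 z) beta0) :
  complex_cvg_in_probability P beta beta0.
Proof.
have mx j : cmeas (x j) by exact/complex_rvP/hR1_rv.
have Vx j : mean_ge0 P (fun w => normc (x j w) ^+ 2) = (s ^+ 2)%:E.
  by rewrite -(hR1_var j) unlock.
have mb N : cmeas_mx (rescaled_col x N.+1) by exact: cmeas_rescaled_col.
have mC N : cmeas_mx (C N) by move=> i j; exact/complex_rvP.
have hsol N w : exists u,
    nonpositive_solution (a N w) (rescaled_col x N.+1 w) (C N w) u (beta N w).
  exact: nonpositive_type_solution.
have mbeta N : cmeas (beta N).
  exact: cmeas_nonpositive_eigenvalue (ha N) (mb N) (mC N) (hCherm N) (hsol N).
split=> [N|eps eps0]; first exact/complex_rvP.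
have stable := gznt_is_stable htheta hbeta0.
apply: near_le_cvg0 => // r r0.
have r3 : 0 < r / 3 by rewrite divr_gt0.
(* [B] makes Markov's bound [s ^+ 2 / B ^+ 2] on the truncation_tail of the column at
   most [r / 3]. *)
set B := 1 + s ^+ 2 / (r / 3).
have q0 : 0 <= s ^+ 2 / (r / 3) by rewrite divr_ge0 ?sqr_ge0// ltW.
have B1 : 1 <= B by rewrite lerDl.
have B0 : 0 < B by exact: lt_le_trans B1.
have Bs : s ^+ 2 / B ^+ 2 <= r / 3.
  rewrite ler_pdivrMr ?exprn_gt0// -ler_pdivrMl// mulrC.
  by rewrite (@le_trans _ _ B)// ?lerDr// expr2 ler_peMr// ltW.
have [z [delta [hz delta0 close]]] := stable B eps B0 eps0.
set Q0 := (fun u : R[i] => - u + (s ^+ 2)%:C * stieltjes mu0 u) in close.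
set dev := deviation x s C z; set terr := trace_error C mu0 z.
have schurE N w : schur_function (a N w) (rescaled_col x N.+1 w) (C N w) z - Q0 z =
    (a N w)%:C + dev N w + (s ^+ 2)%:C * terr N w.
  rewrite /schur_function /Q0 /dev /deviation /terr /trace_error.
  rewrite (rmorphM (real_complex R)) /=; ring.
have mschur N : cmeas (fun w => schur_function (a N w) (rescaled_col x N.+1 w) (C N w) z - Q0 z).
  apply: cmeasB; last exact: cmeas_cst.
  exact: cmeas_schur.
have msqr N : measurable_fun setT (fun w => normsq (rescaled_col x N.+1 w)).
  exact: measurable_normsq.
have mdev N : cmeas (dev N) by exact: cmeas_deviation.
have mterr N : cmeas (terr N).
  apply: cmeasB; last exact: cmeas_cst.
  by apply: cmeasM; [exact: cmeas_cst|exact: cmeas_trace_resolvent].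
set s1 := s ^+ 2 + 1.
have s10 : 0 < s1 by rewrite ltr_wpDl ?sqr_ge0.
have d3 : 0 < delta / 3 by rewrite divr_gt0.
have ds : 0 < delta / 3 / s1 by rewrite divr_gt0.
have r33 : 0 < r / 3 / 3 by rewrite divr_gt0.
have naB := cvg0_near_le (hR0_cvg.2 B B0) r3.
have na := cvg0_near_le (hR0_cvg.2 _ d3) r33.
have ndev := cvg0_near_le (deviation_cvg0 hR1_rv hR1_indep hR1_law hR1_mean Vx
  hC hCherm hR1_indepC hz d3) r33.
have nterr := cvg0_near_le (trace_error_cvg0 hCherm hlambda hR2 hz ds) r33.
have mgt (f : T -> R) (c : R) : measurable_fun setT f -> measurable [set w | c < f w].
  by move=> mf; apply: measurable_ltr_set => //; exact: measurable_cst.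
have mabs N : measurable_fun setT (fun w => `|a N w - 0|).
  by apply: measurableT_comp => //; apply: measurable_funB => //; exact: measurable_cst.
near=> N.
have hschur : (P [set w | (delta < normc (schur_function (a N w) (rescaled_col x N.+1 w) (C N w) z
     - Q0 z))%R] <= (r / 3)%:E)%E.
  apply: (@probability_le_union3 _ _ _ _
    [set w | delta / 3 < `|a N w - 0|] [set w | delta / 3 < normc (dev N w)]
    [set w | delta / 3 / s1 < normc (terr N w)]).
  - exact: mgt.
  - by apply: mgt; exact: cmeas_normc.
  - by apply: mgt; exact: cmeas_normc.
  - by apply: mgt; exact: cmeas_normc.
  - move=> w /= hw.
    have [h1|h1] := ltP (delta / 3) `|a N w - 0|; first by left; left.
    have [h2|h2] := ltP (delta / 3) (normc (dev N w)); first by left; right.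
    right; rewrite ltNge; apply/negP => h3; move: hw; apply/negP; rewrite -leNgt.
    rewrite schurE (le_trans (normc_add _ _))//.
    rewrite (_ : delta = delta / 3 + delta / 3 + delta / 3); last by lra.
    apply: lerD; first rewrite (le_trans (normc_add _ _))// lerD//.
      by rewrite normc_real -[a N w]subr0.
    rewrite normc_mul normc_real ger0_norm ?sqr_ge0//.
    apply: (@le_trans _ _ (s1 * normc (terr N w))).
      by rewrite ler_wpM2r ?normc_ge0// lerDl.
    by rewrite mulrC -ler_pdivlMr.
  - by near: N.
  - by near: N.
  - by near: N.
apply: (@probability_le_union3 _ _ _ _
    [set w | B < `|a N w - 0|] [set w | B ^+ 2 < normsq (rescaled_col x N.+1 w)]
    [set w | delta < normc (schur_function (a N w) (rescaled_col x N.+1 w) (C N w) z - Q0 z)]).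
- exact: mgt.
- exact: mgt.
- by apply: mgt; exact: cmeas_normc.
- apply: mgt; apply: cmeas_normc; apply: cmeasB => //; exact: cmeas_cst.
- move=> w /= hw.
  have [h1|h1] := ltP B `|a N w - 0|; first by left; left.
  have [h2|h2] := ltP (B ^+ 2) (normsq (rescaled_col x N.+1 w)); first by left; right.
  right; rewrite ltNge; apply/negP => h3; move: hw; apply/negP; rewrite -leNgt.
  have [u hu] := hsol N w; rewrite subr0 in h1.
  exact: close hu h1 h2 h3.
- by near: N.
- apply: le_trans (normsq_rescaled_col_tight hR1_rv Vx N B0) _.
  by rewrite lee_fin.
- exact: hschur.
Unshelve. all: by end_near. Qed.
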